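(* Let $k$ be an algebraically closed field of characteristic zero. Let $\varphi_2'\colon\mathbf{S}_5\to PGL_4(k)$ be the faithful representation described in the context, let $\psi_2'=\varphi_2'|_{\mathbf{A}_5}$, and put $$f_0'=x^3y-y^3z+z^3t+t^3x-\tfrac{\sqrt3}{2}x^2z^2-\tfrac{\sqrt3}{2}y^2t^2,$$ $$f_1'=x^3y+y^3z+z^3t-t^3x+\sqrt3\,x^2z^2-\sqrt3\,y^2t^2+3\sqrt3\,xyzt.$$ Then the nonsingular eigenspaces of $\varphi_2'(\mathbf{S}_5)$ in $\mathrm{Form}_{4,4}$ are exactly $\langle f_0'\rangle$ and $\langle f_1'\rangle$, and the (unique) nonsingular eigenspace of $\psi_2'(\mathbf{A}_5)$ in $\mathrm{Form}_{4,4}$ is $\langle f_0',f_1'\rangle$.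
   Context: $\mathrm{Form}_{n,d}$ is the space of homogeneous polynomials of degree $d$ in $n$ variables over $k$ (variables $x,y,z,t$ when $n=4$). For $A\in GL_n(k)$, $f_{A^{-1}}$ denotes the form $v\mapsto f(Av)$, and $(A)$ is the class of $A$ in $PGL_n(k)$. A form $f\ne0$ is nonsingular if $V_p(f)\subset\mathbf{P}^{n-1}(k)$ is nonsingular. Eigenspaces: for a finite subgroup $G\subset PGL_n(k)$, a generating section is a finite set $\{A_1,\dots,A_m\}\subset GL_n(k)$ with $G=\langle (A_1),\dots,(A_m)\rangle$ and $\mathrm{ord}((A_i))=\mathrm{ord}(A_i)=d_i<\infty$. For $\rho=[\rho_1,\dots,\rho_m]$ with $\rho_i\in k^*$, $\rho_i^{d_i}=1$, consider $\{f\in\mathrm{Form}_{n,d}: f_{A_i^{-1}}=\rho_i f\ (1\le i\le m)\}$. When this space is nonzero it is called an eigenspace of $G$ in $\mathrm{Form}_{n,d}$, and when it contains a nonsingular form it is called a nonsingular eigenspace. The collection of (nonsingular) eigenspaces does not depend on the generating section. Definition of $\varphi_2'$: fix a square root $\sqrt3\in k$ of $3$ and $\varepsilon\in k^*$ of order $5$. $\varphi_2'$ is the injective group homomorphism $\mathbf{S}_5\to PGL_4(k)$ determined by $\varphi_2'((12345))=(\mathrm{diag}[\varepsilon,\varepsilon^2,\varepsilon^4,\varepsilon^3])$ and $\varphi_2'((12))=(R_{24}')$, where $$R_{24}'=\frac15\begin{bmatrix} \sqrt3(\varepsilon^2-\varepsilon^3)&1+2\varepsilon^3+2\varepsilon^4&\sqrt3(\varepsilon-\varepsilon^4)&1+2\varepsilon^2+2\varepsilon^4\\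 1+2\varepsilon^3+2\varepsilon^4&\sqrt3(-\varepsilon+\varepsilon^4)&1+2\varepsilon^2+2\varepsilon^4&\sqrt3(\varepsilon^2-\varepsilon^3)\\ \sqrt3(\varepsilon-\varepsilon^4)&1+2\varepsilon^2+2\varepsilon^4&\sqrt3(-\varepsilon^2+\varepsilon^3)&1+2\varepsilon+2\varepsilon^2\\ 1+2\varepsilon^2+2\varepsilon^4&\sqrt3(\varepsilon^2-\varepsilon^3)&1+2\varepsilon+2\varepsilon^2&\sqrt3(\varepsilon-\varepsilon^4) \end{bmatrix}.$$ (The elements $(12)$ and $(12345)$ generate $\mathbf{S}_5$.) *)

(* Defs.v *)
From HB Require Import structures.
From mathcomp Require Import all_boot all_order all_algebra.
From mathcomp Require Import all_fingroup all_solvable generic_quotient.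
From mathcomp Require Import mpoly.

Set Implicit Arguments.
Unset Strict Implicit.
Unset Printing Implicit Defensive.

Import GRing.Theory.
Local Open Scope ring_scope.
Local Open Scope quotient_scope.

(* {'GL_n[R]} requires a finite ring, hence these (possibly infinite) groups. *)
Section LinearGroups.
Context (k : fieldType) (n : nat).

Record GLn := MkGL { GLmx :> 'M[k]_n; _ : GLmx \in unitmx }.

HB.instance Definition _ := [isSub for GLmx].
HB.instance Definition _ := [Choice of GLn by <:].

Lemma GL_unit (A : GLn) : GLmx A \in unitmx.
Proof. by case: A. Qed.

Fact GL1_subproof : (1%:M : 'M[k]_n) \in unitmx.
Proof. exact: unitmx1. Qed.
Fact GLM_subproof (A B : GLn) : A *m B \in unitmx.
Proof. by rewrite unitmx_mul !GL_unit. Qed.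
Fact GLV_subproof (A : GLn) : invmx A \in unitmx.
Proof. by rewrite unitmx_inv GL_unit. Qed.

Definition GL1 := MkGL GL1_subproof.
Definition GLM A B := MkGL (GLM_subproof A B).
Definition GLV A := MkGL (GLV_subproof A).

Fact GLMA : associative GLM.
Proof. by move=> A B C; apply/val_inj/mulmxA. Qed.
Fact GL1M : left_id GL1 GLM.
Proof. by move=> A; apply/val_inj/mul1mx. Qed.
Fact GLM1 : right_id GL1 GLM.
Proof. by move=> A; apply/val_inj/mulmx1. Qed.
Fact GLVM : left_inverse GL1 GLV GLM.
Proof. by move=> A; apply/val_inj/mulVmx/GL_unit. Qed.
Fact GLMV : right_inverse GL1 GLV GLM.
Proof. by move=> A; apply/val_inj/mulmxV/GL_unit. Qed.

HB.instance Definition _ := isGroup.Build GLn GLMA GL1M GLM1 GLVM GLMV.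

Definition proportional (A B : GLn) : bool := is_scalar_mx (A *m invmx B).

Lemma proportionalP (A B : GLn) :
  reflect (exists a, GLmx A = a *: GLmx B) (proportional A B).
Proof.
apply: (iffP is_scalar_mxP) => -[a eqA]; exists a.
  by rewrite -mul_scalar_mx -eqA mulmxKV ?GL_unit.
by rewrite eqA -scalemxAl mulmxV ?GL_unit // scalemx1.
Qed.

Fact proportional_refl : reflexive proportional.
Proof. by move=> A; apply/proportionalP; exists 1; rewrite scale1r. Qed.

Fact proportional_sym : ssrbool.symmetric proportional.
Proof.
have H A B : proportional A B -> proportional B A.
  case/is_scalar_mxP => a eqA; apply/is_scalar_mxP; exists a^-1.
  have -> : GLmx B *m invmx A = invmx (A *m invmx B).
    rewrite -[LHS]mulmx1 -(@mulmxV _ _ (A *m invmx B)) ?GLM_subproof //.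
      by rewrite mulmxA -(mulmxA _ (invmx A)) (mulmxA (invmx A)) mulVmx ?GL_unit
        // mul1mx mulmxV ?GL_unit // mul1mx.
    exact: (GLM_subproof A (GLV B)).
  by rewrite eqA invmx_scalar.
by move=> A B; apply/idP/idP; apply: H.
Qed.

Fact proportional_trans : transitive proportional.
Proof.
move=> B A C /proportionalP[a eA] /proportionalP[b eB].
by apply/proportionalP; exists (a * b); rewrite eA eB scalerA.
Qed.

Canonical proportional_equiv :=
  EquivRel proportional proportional_refl proportional_sym proportional_trans.

Definition PGLn := {eq_quot proportional}.
HB.instance Definition _ := Choice.on PGLn.
HB.instance Definition _ := EqQuotient.on PGLn.

(* The class (A) of A in PGL_n(k). *)
Definition PGLclass (A : GLn) : PGLn := \pi_PGLn A.

Lemma PGLclass_eqP (A B : GLn) :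
  PGLclass A = PGLclass B <-> exists a, GLmx A = a *: GLmx B.
Proof.
split=> [/eqP|]; first by rewrite piE => /proportionalP.
by move/proportionalP => AB; apply/eqP; rewrite piE.
Qed.

Definition PGL1 := PGLclass GL1.
Definition PGLM (X Y : PGLn) := PGLclass (GLM (repr X) (repr Y)).
Definition PGLV (X : PGLn) := PGLclass (GLV (repr X)).

Lemma PGLclass_repr X : PGLclass (repr X) = X.
Proof. exact: reprK. Qed.

Fact PGLM_class A B : PGLM (PGLclass A) (PGLclass B) = PGLclass (GLM A B).
Proof.
have /PGLclass_eqP[a eA] := PGLclass_repr (PGLclass A).
have /PGLclass_eqP[b eB] := PGLclass_repr (PGLclass B).
apply/PGLclass_eqP; exists (a * b) => /=.
by rewrite eA eB -scalemxAl -scalemxAr scalerA.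
Qed.

Fact PGLV_class A : PGLV (PGLclass A) = PGLclass (GLV A).
Proof.
have /esym/PGLclass_eqP[a eA] := PGLclass_repr (PGLclass A).
apply/PGLclass_eqP; exists a => /=; set B := repr _ in eA *.
rewrite -[RHS](mulmxK (GL_unit B)) -scalemxAl scalemxAr -eA.
by rewrite mulVmx ?GL_unit // mul1mx.
Qed.

Fact PGLMA : associative PGLM.
Proof.
move=> X Y Z; rewrite -(PGLclass_repr X) -(PGLclass_repr Y) -(PGLclass_repr Z).
by rewrite !PGLM_class GLMA.
Qed.
Fact PGL1M : left_id PGL1 PGLM.
Proof. by move=> X; rewrite -(PGLclass_repr X) PGLM_class GL1M. Qed.
Fact PGLM1 : right_id PGL1 PGLM.
Proof. by move=> X; rewrite -(PGLclass_repr X) PGLM_class GLM1. Qed.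
Fact PGLVM : left_inverse PGL1 PGLV PGLM.
Proof.
by move=> X; rewrite -(PGLclass_repr X) PGLV_class PGLM_class GLVM.
Qed.
Fact PGLMV : right_inverse PGL1 PGLV PGLM.
Proof.
by move=> X; rewrite -(PGLclass_repr X) PGLV_class PGLM_class GLMV.
Qed.

HB.instance Definition _ := isGroup.Build PGLn PGLMA PGL1M PGLM1 PGLVM PGLMV.

Lemma PGLclassM (A B : GLn) :
  PGLclass (A * B)%g = (PGLclass A * PGLclass B)%g.
Proof. exact/esym/PGLM_class. Qed.

End LinearGroups.

Section Generation.
Local Open Scope group_scope.
Context (G : groupType).

(* ord(x) = e, with e finite. *)
Definition has_order (x : G) (e : nat) : Prop :=
  [/\ (0 < e)%N, x ^+ e = 1
    & forall i : nat, (0 < i)%N -> (i < e)%N -> x ^+ i <> 1].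

Inductive gen_by (S : G -> Prop) : G -> Prop :=
| gen_by_mem x of S x : gen_by S x
| gen_by_1 : gen_by S 1
| gen_by_M x y of gen_by S x & gen_by S y : gen_by S (x * y)
| gen_by_V x of gen_by S x : gen_by S x^-1.

End Generation.

Section Eigenspaces.
Context (k : fieldType) (n d : nat).

(* Form_{n+1,d}; dhomog is a vectType only when it has n.+1 variables. *)
Notation Form := (dhomog n.+1 k d).

(* f_{A^-1} : v |-> f(Av), with v a column vector; see meval_lin_subst. *)
Definition lin_subst (A : 'M[k]_n.+1) (f : {mpoly k[n.+1]}) : {mpoly k[n.+1]} :=
  f \mPo [tuple \sum_(j < n.+1) A i j *: 'X_j | i < n.+1].

Lemma meval_lin_subst A f (v : 'cV[k]_n.+1) :
  (lin_subst A f).@[fun i => v i 0] = f.@[fun i => (A *m v) i 0].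
Proof.
rewrite /lin_subst comp_mpoly_meval; apply: meval_eq => i.
rewrite tnth_mktuple raddf_sum mxE; apply: eq_bigr => j _.
by rewrite /= mevalZ mevalXU.
Qed.

(* Jacobian criterion: no point of the projective hypersurface f = 0 kills all
   the partial derivatives of f. *)
Definition nonsingular (f : {mpoly k[n.+1]}) : Prop :=
  f != 0 /\
  forall v : 'cV[k]_n.+1, v != 0 -> f.@[fun i => v i 0] = 0 ->
    exists j, (f^`M(j)).@[fun i => v i 0] != 0.

(* A subgroup is given by the list of its elements. *)
Definition generating_section (G : seq (PGLn k n.+1)) (m : nat)
    (A : 'I_m -> GLn k n.+1) (e : 'I_m -> nat) : Prop :=
  [/\ injective A,
      forall x, x \in G <-> gen_by (fun y => exists i, y = PGLclass (A i)) x
    & forall i, has_order (PGLclass (A i)) (e i) /\ has_order (A i) (e i)].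

Definition eigenspace_of (G : seq (PGLn k n.+1)) (E : {vspace Form}) : Prop :=
  exists (m : nat) (A : 'I_m -> GLn k n.+1) (e : 'I_m -> nat) (rho : 'I_m -> k),
    [/\ generating_section G A e,
        forall i, rho i ^+ e i = 1,
        (forall f : Form,
          f \in E <-> forall i, lin_subst (A i) f = rho i *: mpoly_of_dhomog f)
      & E != 0%VS].

Definition nonsingular_eigenspace_of (G : seq (PGLn k n.+1))
    (E : {vspace Form}) : Prop :=
  eigenspace_of G E /\ exists2 f : Form, f \in E & nonsingular f.

End Eigenspaces.

Section Phi2'.
Context (k : fieldType).

(* r3 stands for the chosen square root of 3. *)
Definition D5 (eps : k) : 'M[k]_4 :=
  diag_mx (\row_j [:: eps; eps ^+ 2; eps ^+ 4; eps ^+ 3]`_j).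

Definition R24' (r3 eps : k) : 'M[k]_4 :=
  let rows :=
    [:: [:: r3 * (eps ^+ 2 - eps ^+ 3);  1 + 2 * eps ^+ 3 + 2 * eps ^+ 4;
            r3 * (eps - eps ^+ 4);       1 + 2 * eps ^+ 2 + 2 * eps ^+ 4];
        [:: 1 + 2 * eps ^+ 3 + 2 * eps ^+ 4;  r3 * (- eps + eps ^+ 4);
            1 + 2 * eps ^+ 2 + 2 * eps ^+ 4;  r3 * (eps ^+ 2 - eps ^+ 3)];
        [:: r3 * (eps - eps ^+ 4);            1 + 2 * eps ^+ 2 + 2 * eps ^+ 4;
            r3 * (- eps ^+ 2 + eps ^+ 3);     1 + 2 * eps + 2 * eps ^+ 2];
        [:: 1 + 2 * eps ^+ 2 + 2 * eps ^+ 4;  r3 * (eps ^+ 2 - eps ^+ 3);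
            1 + 2 * eps + 2 * eps ^+ 2;       r3 * (eps - eps ^+ 4)]] in
  5^-1 *: \matrix_(i, j) (nth [::] rows i)`_j.

(* S_5 permutes {0,...,4} instead of {1,...,5}. *)
Definition cycle12345 : 'S_5 := perm (@ordS_inj 5).
Definition transp12 : 'S_5 := tperm (inord 0) (inord 1).

(* MathComp multiplies permutations from left to right.  The convention is
   immaterial: conjugation by a permutation that fixes (12) and inverts (12345),
   followed by inversion, is an anti-automorphism of S_5 fixing both
   generators and preserving A_5. *)
Definition is_phi2' (r3 eps : k) (phi : {multiplicative 'S_5 -> PGLn k 4}) : Prop :=
  [/\ injective phi,
      exists2 A : GLn k 4, GLmx A = D5 eps & phi cycle12345 = PGLclass A
    & exists2 A : GLn k 4, GLmx A = R24' r3 eps & phi transp12 = PGLclass A].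

Definition phi2'_S5 (phi : 'S_5 -> PGLn k 4) : seq (PGLn k 4) :=
  [seq phi s | s : 'S_5].
Definition psi2'_A5 (phi : 'S_5 -> PGLn k 4) : seq (PGLn k 4) :=
  [seq phi s | s in ('Alt_('I_5))%g].

Let x : {mpoly k[4]} := 'X_(@Ordinal 4 0 isT).
Let y : {mpoly k[4]} := 'X_(@Ordinal 4 1 isT).
Let z : {mpoly k[4]} := 'X_(@Ordinal 4 2 isT).
Let t : {mpoly k[4]} := 'X_(@Ordinal 4 3 isT).

Definition f0'_poly (r3 : k) : {mpoly k[4]} :=
  x ^+ 3 * y - y ^+ 3 * z + z ^+ 3 * t + t ^+ 3 * x
  - (r3 / 2) *: (x ^+ 2 * z ^+ 2) - (r3 / 2) *: (y ^+ 2 * t ^+ 2).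

Definition f1'_poly (r3 : k) : {mpoly k[4]} :=
  x ^+ 3 * y + y ^+ 3 * z + z ^+ 3 * t - t ^+ 3 * x
  + r3 *: (x ^+ 2 * z ^+ 2) - r3 *: (y ^+ 2 * t ^+ 2)
  + (3 * r3) *: (x * y * z * t).

Let homX i : ('X_i : {mpoly k[4]}) \is 1.-homog.
Proof. by rewrite dhomogX /= mdeg1. Qed.

Let homXn i e : ('X_i ^+ e : {mpoly k[4]}) \is e.-homog.
Proof. by have := dhomogMn e (homX i); rewrite mul1n. Qed.

Fact f0'_homog (r3 : k) : f0'_poly r3 \is 4.-homog.
Proof.
by do ![apply: rpredD | apply: rpredB | rewrite rpredN | apply: rpredZ];
  first [exact: (dhomogM (homXn _ 3) (homX _))
        | exact: (dhomogM (homXn _ 2) (homXn _ 2))].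
Qed.

Fact f1'_homog (r3 : k) : f1'_poly r3 \is 4.-homog.
Proof.
by do ![apply: rpredD | apply: rpredB | rewrite rpredN | apply: rpredZ];
  first [exact: (dhomogM (homXn _ 3) (homX _))
        | exact: (dhomogM (homXn _ 2) (homXn _ 2))
        | exact: (dhomogM (dhomogM (dhomogM (homX _) (homX _)) (homX _)) (homX _))].
Qed.

Definition f0' (r3 : k) : dhomog 4 k 4 := DHomog (f0'_homog r3).
Definition f1' (r3 : k) : dhomog 4 k 4 := DHomog (f1'_homog r3).

End Phi2'.

(* Main.v *)
Require Import Defs.
From HB Require Import structures.
From mathcomp Require Import all_boot all_order all_algebra.
From mathcomp Require Import all_fingroup all_solvable.
From mathcomp Require Import mpoly ring.

Set Implicit Arguments.
Unset Strict Implicit.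
Unset Printing Implicit Defensive.

Import GRing.Theory.
Local Open Scope ring_scope.

(* Write A = D5 and B = R24', representing a 5-cycle and a transposition.  In A_5
   each 5-cycle is conjugate to its inverse, so any lift of it of order 5 and
   determinant 1 acts trivially on an eigenspace of A_5 (degree = dimension = 4).
   Since A_5 is generated by the classes of A and C = B A B^-1, every form f of
   an eigenspace is such that f and f(B v) are both invariant under A, i.e.
   combinations of x^3 y, y^3 z, z^3 t, t^3 x, x^2 z^2, y^2 t^2 and xyzt; solving
   the resulting linear system gives the plane <f0', f1'>.  A transposition acts
   on it with eigenvalues 1 and -1, which gives the two eigenlines of S_5.  Two
   eigenspaces of the same group that share a nonzero form are equal. *)

(** * Linear substitutions *)

Section LinearSubstitution.
Context (k : fieldType) (n d : nat).
Implicit Types (A B : 'M[k]_n.+1) (f : {mpoly k[n.+1]}).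

HB.instance Definition _ A := GRing.Linear.copy (lin_subst A)
  (comp_mpoly [tuple \sum_(j < n.+1) A i j *: 'X_j | i < n.+1]).

HB.instance Definition _ A := GRing.LRMorphism.copy (lin_subst A)
  (comp_mpoly [tuple \sum_(j < n.+1) A i j *: 'X_j | i < n.+1]).

Lemma lin_substXU A i : lin_subst A 'X_i = \sum_j A i j *: 'X_j.
Proof. by rewrite /lin_subst comp_mpolyXU -tnth_nth tnth_mktuple. Qed.

Lemma lin_substX A (m : 'X_{1..n.+1}) :
  lin_subst A 'X_[m] = \prod_i (\sum_j A i j *: 'X_j) ^+ m i.
Proof.
by rewrite /lin_subst comp_mpolyX; apply: eq_bigr => i _; rewrite tnth_mktuple.
Qed.

Lemma lin_substE A f :
  lin_subst A f = \sum_(m <- msupp f) f@_m *: lin_subst A 'X_[m].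
Proof.
rewrite {1}(mpolyE f) raddf_sum; apply: eq_bigr => m _.
by rewrite [LHS]linearZ.
Qed.

(** Precomposition with linear maps is a right action. The identity is checked on monomials and then
    on variables, as an identity of polynomials rather than of functions on [k^n]. *)
Lemma lin_substM A B f : lin_subst (A *m B) f = lin_subst B (lin_subst A f).
Proof.
rewrite lin_substE (lin_substE A f) [RHS]raddf_sum; apply: eq_bigr => m _.
rewrite [RHS]linearZ !lin_substX; congr (_ *: _); rewrite [RHS]rmorph_prod.
apply: eq_bigr => i _; rewrite [RHS]rmorphXn; congr (_ ^+ _).
transitivity (\sum_l \sum_j (A i j * B j l) *: 'X_l : {mpoly k[n.+1]}).
  by apply: eq_bigr => l _; rewrite mxE scaler_suml.
rewrite exchange_big [RHS]raddf_sum; apply: eq_bigr => j _.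
rewrite [RHS]linearZ /= lin_substXU scaler_sumr.
by apply: eq_bigr => l _; rewrite scalerA.
Qed.

Lemma lin_subst1 f : lin_subst 1%:M f = f.
Proof.
rewrite lin_substE [RHS](mpolyE f); apply: eq_bigr => m _.
rewrite lin_substX [in RHS]mpolyXE_id; congr (_ *: _).
apply: eq_bigr => i _; congr (_ ^+ _); rewrite (bigD1 i) //= big1 ?addr0.
  by rewrite mxE eqxx scale1r.
by move=> j neq; rewrite mxE eq_sym (negbTE neq) scale0r.
Qed.

Lemma lin_substZ (a : k) A f : f \is d.-homog ->
  lin_subst (a *: A) f = a ^+ d *: lin_subst A f.
Proof.
move=> /dhomogP homf; rewrite !lin_substE scaler_sumr !big_seq.
apply: eq_bigr => m /homf /(id : _ -> mdeg m = d) mdegm; rewrite !lin_substX scalerA mulrC -scalerA.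
congr (_ *: _); rewrite -mdegm mdegE -prodrXr -scaler_prod.
apply: eq_bigr => i _; rewrite -exprZn scaler_sumr; congr (_ ^+ _).
by apply: eq_bigr => j _; rewrite mxE scalerA.
Qed.

Lemma lin_subst_homog A f : f \is d.-homog -> lin_subst A f \is d.-homog.
Proof.
move=> /dhomogP homf; rewrite lin_substE big_seq; apply: rpred_sum => m.
move=> /homf /(id : _ -> mdeg m = d) <-; apply: rpredZ.
rewrite lin_substX mdegE; elim/big_rec2: _ => [|i l p _ homp].
  exact: dhomog1.
apply: dhomogM homp.
have hom1 : \sum_j A i j *: 'X_j \is [in k[n.+1], 1.-homog].
  by apply: rpred_sum => j _; apply: rpredZ; rewrite dhomogX /= mdeg1.
by rewrite -[X in X.-homog]mul1n; apply: dhomogMn.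
Qed.

(** A diagonal substitution only rescales each monomial, so invariance under it can be tested
    coefficient by coefficient. *)
Lemma mcoeff_lin_subst_diag (D : 'rV[k]_n.+1) f m :
  (lin_subst (diag_mx D) f)@_m = (\prod_i D 0 i ^+ m i) * f@_m.
Proof.
rewrite lin_substE [in RHS](mpolyE f) !raddf_sum mulr_sumr.
apply: eq_bigr => m' _; rewrite lin_substX.
under eq_bigr => i _.
  rewrite (bigD1 i) //= big1 ?addr0; last first.
    by move=> j neq; rewrite !mxE eq_sym (negbTE neq) scale0r.
  rewrite !mxE eqxx exprZn; over.
rewrite scaler_prod -mpolyXE_id /= !mcoeffZ mcoeffX.
by case: eqP => [->|_]; rewrite ?mulr0 // mulrCA.
Qed.

End LinearSubstitution.

(** * Eigenspaces as spaces of semi-invariants *)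

Section Semiinvariants.
Context (k : fieldType) (n d : nat).
Notation Form := (dhomog n.+1 k d).
Implicit Types (A B : GLn k n.+1) (E : {vspace Form}) (G : seq (PGLn k n.+1)).

Definition acts_by E A (c : k) : Prop :=
  forall f : Form, f \in E -> lin_subst A f = c *: mpoly_of_dhomog f.

Lemma acts_by_inj E A c c' : E != 0%VS -> acts_by E A c -> acts_by E A c' ->
  c = c'.
Proof.
rewrite -vpick0 => nz /(_ _ (memv_pick E)) + /(_ _ (memv_pick E)).
move=> -> /eqP; rewrite -subr_eq0 -scalerBl scaler_eq0 subr_eq0 => /orP[/eqP //|/eqP f0].
by case/eqP: nz; apply: val_inj.
Qed.

Lemma acts_by1 E : acts_by E 1%g 1.
Proof. by move=> f _; rewrite scale1r; apply: lin_subst1. Qed.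

Lemma acts_byM E A B a b : acts_by E A a -> acts_by E B b ->
  acts_by E (A * B)%g (a * b).
Proof.
move=> EA EB f Ef; rewrite [LHS](lin_substM A B) EA // [LHS]linearZ /= EB //.
by rewrite scalerA.
Qed.

Lemma acts_byV E A c : acts_by E A c -> acts_by E A^-1%g c^-1.
Proof.
move=> EA f Ef; have: lin_subst (A * A^-1)%g f = f.
  by rewrite mulgV; apply: lin_subst1.
rewrite [lin_subst _ _](lin_substM A A^-1%g) EA // [lin_subst _ _]linearZ /=.
(* If [c = 0] then [f = 0], so the conventional value [0^-1 = 0] is harmless. *)
move=> eqf; have [c0 | c0] := eqVneq c 0.
  by rewrite -eqf c0 scale0r scaler0 [LHS]linear0.
by rewrite -[in RHS]eqf scalerA mulVf // scale1r.
Qed.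

Lemma acts_byX E A c m : acts_by E A c -> acts_by E (A ^+ m)%g (c ^+ m).
Proof.
move=> EA; elim: m => [|m IH]; first exact: acts_by1.
by rewrite expgS exprS; apply: acts_byM.
Qed.

Lemma acts_byZ E A B a c : GLmx B = a *: GLmx A -> acts_by E A c ->
  acts_by E B (a ^+ d * c).
Proof.
move=> eqB EA f Ef; rewrite [X in lin_subst X _]eqB.
by rewrite (@lin_substZ _ _ d) ?dhomog_is_dhomog // EA // scalerA.
Qed.

(** The induction runs over all lifts [A] of [x] at once: a lift of a product agrees with the
    product of the chosen representatives only up to a scalar, which [acts_byZ] absorbs. *)
Lemma gen_by_acts_by (S : PGLn k n.+1 -> Prop) E :
    (forall A, S (PGLclass A) -> exists c, acts_by E A c) ->
  forall x A, gen_by S x -> PGLclass A = x -> exists c, acts_by E A c.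
Proof.
move=> ES x A Sx; elim: Sx A => {x} [x Sx A Ax|A /PGLclass_eqP[a eA]|x y _ IHx _ IHy A|x _ IHx A].
- by apply: ES; rewrite Ax.
- by eexists; apply: acts_byZ eA (@acts_by1 _).
- rewrite -[x]PGLclass_repr -[y]PGLclass_repr.
  rewrite -PGLclassM => /PGLclass_eqP[a eA].
  have [[c Ex] [c' Ey]] := (IHx _ (PGLclass_repr x), IHy _ (PGLclass_repr y)).
  by eexists; apply: acts_byZ eA (acts_byM Ex Ey).
- rewrite -[x]PGLclass_repr.
  rewrite [(_^-1)%g]PGLV_class => /PGLclass_eqP[a eA].
  have [c Ex] := IHx _ (PGLclass_repr x).
  by eexists; apply: acts_byZ eA (acts_byV Ex).
Qed.

(** Scalar action passes from the generators defining [E] to the whole group. This makes eigenspaces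
    given by different generating sections comparable. *)
Lemma eigenspace_acts_by G E A : eigenspace_of G E -> PGLclass A \in G ->
  exists c, acts_by E A c.
Proof.
move=> [m [B [e [rho [[_ genG _] _ memE _]]]]] /genG GA.
apply: gen_by_acts_by GA erefl => C [i /PGLclass_eqP[a eC]].
by eexists; apply: acts_byZ eC _ => f /memE.
Qed.

(** Each generator in the section defining one space acts on the other by a single scalar, and this
    scalar can be read off on the common form [f]. Hence each space satisfies the equations of the
    other. *)
Lemma eigenspace_inj G E E' (f : Form) : eigenspace_of G E ->
  eigenspace_of G E' -> f \in E -> f \in E' -> f != 0 -> E = E'.
Proof.
move=> eigE eigE' Ef E'f f0; apply/eqP; rewrite eqEsubv; apply/andP.
suff sub E1 E2 : eigenspace_of G E1 -> eigenspace_of G E2 -> f \in E1 ->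
    f \in E2 -> (E2 <= E1)%VS by split; apply: sub.
move=> [m [A [e [rho [[_ genG _] _ memE1 _]]]]] eig2 E1f E2f.
apply/subvP => g E2g; apply/memE1 => i.
have /(eigenspace_acts_by eig2)[c Ec] : PGLclass (A i) \in G.
  by apply/genG; apply: gen_by_mem; exists i.
have /memE1/(_ i) := E1f; rewrite !Ec // => /eqP.
rewrite -subr_eq0 -scalerBl scaler_eq0 subr_eq0 => /orP[/eqP -> //|/eqP v0].
by case/eqP: f0; apply: val_inj.
Qed.

(* In PGL, [B] inverts [A]; comparing determinants and scalars of the lifts
   gives c^2 = (det A)^2, and both are fifth roots of unity. *)
Lemma acts_by_det E A B b c : d = n.+1 -> E != 0%VS ->
  acts_by E A c -> acts_by E B b -> (A ^+ 5 = 1)%g ->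
  (PGLclass B * PGLclass A = (PGLclass A)^-1 * PGLclass B)%g -> c = \det A.
Proof.
move=> dn E0 EA EB A5; rewrite [(_^-1)%g]PGLV_class -!PGLclassM.
case/PGLclass_eqP => a eBA.
have detA : \det A != 0 by have := Defs.GL_unit A; rewrite unitmxE unitfE.
have detB : \det B != 0 by have := Defs.GL_unit B; rewrite unitmxE unitfE.
have c5 : c ^+ 5 = 1.
  by apply: acts_by_inj E0 _ (@acts_by1 E); rewrite -A5; apply: acts_byX.
have det5 : \det A ^+ 5 = 1.
  have := congr1 (fun X : GLn k n.+1 => \det X) A5.
  by rewrite !expgS expg0 /= !det_mulmx !det1 mulr1 !exprS expr0 mulr1.
have c0 : c != 0 by apply: contra_eq_neq c5 => ->; rewrite expr0n eq_sym oner_eq0.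
have b0 : b != 0.
  have := acts_byM EB (acts_byV EB); rewrite mulgV => /acts_by_inj.
  move=> /(_ _ E0 (@acts_by1 E)) bV; apply: contra_eq_neq bV => ->.
  by rewrite mul0r eq_sym oner_eq0.
(* This is used once for determinants, with [q = a ^+ n.+1], and once for eigenvalues, with
   [q = a ^+ d]; as [d = n.+1], the two squares coincide. *)
have sq (x y q : k) : x != 0 -> y != 0 -> y * x = q * (x^-1 * y) -> q = x ^+ 2.
  move=> x0 y0 eqyx; apply: (mulIf y0).
  by rewrite expr2 -mulrA [x * y]mulrC eqyx mulrCA mulVKf.
have := acts_by_inj E0 (acts_byM EB EA) (acts_byZ eBA (acts_byM (acts_byV EA) EB)).
have := congr1 determinant eBA; rewrite detZ /= !det_mulmx det_inv dn.
move=> /(sq _ _ _ detA detB) -> /(sq _ _ _ c0 b0) eq2.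
(* Both are fifth roots of unity, so [c = c^6 = (c^2)^3], and likewise for the determinant. *)
rewrite -[c]mulr1 -c5 -[\det A]mulr1 -det5 -!exprS (exprM c 2 3) -eq2.
by rewrite -exprM.
Qed.

End Semiinvariants.

(** * Images of generated subgroups under a homomorphism *)

Section GroupGeneration.
Local Open Scope group_scope.

Lemma gen_by_sub (G : groupType) (S S' : G -> Prop) x :
  (forall y, S y -> S' y) -> gen_by S x -> gen_by S' x.
Proof.
move=> sub; elim=> [y /sub|| y z _ Sy _ Sz| y _ Sy].
- exact: gen_by_mem.
- exact: gen_by_1.
- exact: gen_by_M.
- exact: gen_by_V.
Qed.

Context (gT : finGroupType) (H : groupType) (phi : {multiplicative gT -> H}).

Lemma multiplicative1 : phi 1 = 1.
Proof. by apply: (mulgI (phi 1)); rewrite -gmulfM !mulg1. Qed.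

Lemma multiplicativeV x : phi x^-1 = (phi x)^-1.
Proof.
by apply: (mulgI (phi x)); rewrite -gmulfM !mulgV multiplicative1.
Qed.

Lemma multiplicativeX x n : phi (x ^+ n) = phi x ^+ n.
Proof.
elim: n => [|n IH]; first by rewrite !expg0 multiplicative1.
by rewrite !expgS gmulfM IH.
Qed.

(** This links subgroups generated inside a finite group with [gen_by] in the possibly infinite
    target. By finiteness, elements of [<<A>>] are plain products of elements of [A]. *)
Lemma gen_by_image (A : {set gT}) y :
  (exists2 x, x \in <<A>> & y = phi x) <->
  gen_by (fun z => exists2 x, x \in A & z = phi x) y.
Proof.
split=> [[x /gen_prodgP[n [c Ac ->]] ->]|].
  elim/big_ind: _ => [|u v Pu Pv|i _].
  - by rewrite multiplicative1; apply: gen_by_1.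
  - by rewrite gmulfM; apply: gen_by_M.
  - by apply: gen_by_mem; exists (c i).
elim=> [z [x Ax ->]||z w _ [x Ax ->] _ [x' Ax' ->]|z _ [x Ax ->]].
- by exists x; rewrite ?mem_gen.
- by exists 1; rewrite ?group1 ?multiplicative1.
- by exists (x * x'); rewrite ?groupM ?gmulfM.
- by exists x^-1; rewrite ?groupV ?multiplicativeV.
Qed.

End GroupGeneration.

(** * Eigenspaces given by a generating section with two elements *)

Section TwoGenerators.
Context (k : fieldType) (n d : nat).
Notation Form := (dhomog n.+1 k d).

Lemma PGLclassX (A : GLn k n.+1) m : PGLclass (A ^+ m)%g = (PGLclass A ^+ m)%g.
Proof. by elim: m => [|m IH]; rewrite ?expg0 // !expgS PGLclassM IH. Qed.

(** Injectivity of [phi] gives the class of [A] the order of [s]. A smaller exponent killing [A]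
    would also kill its class, so [A] has that order too. *)
Lemma has_order_lift (gT : finGroupType) (phi : {multiplicative gT -> PGLn k n.+1})
    (s : gT) (A : GLn k n.+1) : injective phi -> phi s = PGLclass A ->
  (A ^+ #[s] = 1)%g -> has_order (PGLclass A) #[s]%g /\ has_order A #[s]%g.
Proof.
move=> inj_phi phi_s As; rewrite /has_order order_gt0 As -PGLclassX As.
have ne1 i : (0 < i)%N -> (i < #[s]%g)%N -> (PGLclass A ^+ i)%g <> 1%g.
  move=> i0 lti; rewrite -phi_s -multiplicativeX -(multiplicative1 phi).
  move=> /inj_phi/eqP; rewrite -order_dvdn => /(dvdn_leq i0).
  by rewrite leqNgt lti.
split; split=> // i i0 lti Ai; apply: (ne1 i i0 lti).
by rewrite -PGLclassX Ai.
Qed.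

Lemma eigenspace_of_pair (G : seq (PGLn k n.+1)) (E : {vspace Form})
    (A B : GLn k n.+1) (a b : k) (e e' : nat) :
    A <> B ->
    (forall x, x \in G <-> gen_by (fun y => y = PGLclass A \/ y = PGLclass B) x) ->
    has_order (PGLclass A) e /\ has_order A e ->
    has_order (PGLclass B) e' /\ has_order B e' -> a ^+ e = 1 -> b ^+ e' = 1 ->
    (forall f : Form, f \in E <->
       lin_subst A f = a *: mpoly_of_dhomog f /\
       lin_subst B f = b *: mpoly_of_dhomog f) ->
    E != 0%VS ->
  eigenspace_of G E.
Proof.
move=> AB genG oA oB ae be memE E0.
exists 2%N, (fun i => if i == ord0 then A else B).
exists (fun i => if i == ord0 then e else e').
exists (fun i => if i == ord0 then a else b).
have ord2 (P : 'I_2 -> Prop) : P ord0 -> P ord_max -> forall i, P i.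
  move=> P0 P1 [[|[|m]] lti] //.
    by rewrite (_ : Ordinal lti = ord0) //; apply: val_inj.
  by rewrite (_ : Ordinal lti = ord_max) //; apply: val_inj.
split=> //; [split|by elim/ord2|].
- by elim/ord2; elim/ord2 => //= /esym.
- move=> x; rewrite genG; split; apply: gen_by_sub => y.
    by case=> ->; [exists ord0 | exists ord_max].
  by case; elim/ord2 => ->; [left | right].
- by elim/ord2.
- move=> f; rewrite memE; split=> [[fA fB]|fi]; first by elim/ord2.
  by split; [exact: (fi ord0) | exact: (fi ord_max)].
Qed.

End TwoGenerators.

(** * The symmetric group S_5 *)

Section SymmetricGroup.
Local Open Scope group_scope.

Local Notation c := cycle12345.
Local Notation tau := transp12.
Local Notation r := (perm (@rev_ord_inj 5)).

Lemma cycle12345X5 : c ^+ 5 = 1.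
Proof.
apply/permP => i; apply: val_inj.
by rewrite permX /= !permE /=; case: i => -[|[|[|[|[|]]]]].
Qed.

Lemma cycle12345_neq1 : c != 1.
Proof. by apply/eqP => /permP/(_ ord0)/(congr1 val); rewrite !permE. Qed.

Lemma order_cycle12345 : #[c] = 5%N.
Proof. exact: nt_prime_order cycle12345X5 cycle12345_neq1. Qed.

Lemma order_transp12 : #[tau] = 2%N.
Proof.
apply: nt_prime_order => //; first exact: tperm2.
by apply/eqP => /permP/(_ (inord 0))/(congr1 val); rewrite tpermL perm1 /= !inordK.
Qed.

Lemma transp12V : tau^-1 = tau.
Proof. exact: tpermV. Qed.

Lemma gen_S5 : <<[set tau; c]>> = [set: 'S_5].
Proof. have -> : c = perm (addrI (1%R : 'I_5)).
  by apply/permP => i; rewrite !permE (@add_1_Zp 5).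
by apply: gen_tpermn_circular_shift; rewrite /= !inordK. Qed.

(** The reversal [i |-> 4 - i] is the product of two disjoint transpositions. It serves as the even
    permutation that inverts the 5-cycle. *)
Lemma rev_ord_Alt5 : r \in 'Alt_('I_5).
Proof.
suff -> : r = tperm (inord 0) (inord 4) * tperm (inord 1) (inord 3).
  by rewrite Alt_even odd_permM !odd_tperm -!val_eqE /= !inordK.
apply/permP => i; apply: val_inj; rewrite permM /tperm !permE /=.
by case: i => -[|[|[|[|[|]]]]] lti //=; rewrite -?val_eqE /= ?inordK //=.
Qed.

Lemma rev_ord_cycle12345 : r * c = c^-1 * r.
Proof.
apply: (mulgI c); rewrite mulKVg; apply/permP => i; apply: val_inj.
by rewrite !permM !permE /=; case: i => -[|[|[|[|[|]]]]].
Qed.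

(** The sign of [c] has trivial fifth power, hence is trivial. *)
Lemma cycle12345_Alt : c \in 'Alt_('I_5).
Proof.
rewrite Alt_even; have := congr1 (@odd_perm _) cycle12345X5.
by rewrite !expgS expg0 !odd_permM odd_perm1; case: odd_perm.
Qed.

Lemma cycle12345_conj_neq : c <> c ^ tau.
Proof.
move/permP/(_ (inord 0))/(congr1 val); rewrite /conjg transp12V !permM tpermL.
by rewrite tpermD -?val_eqE !permE /= !inordK.
Qed.

(** Conjugation by [tau] swaps the two generators, so the subgroup is normalized by [c] and [tau],
    that is, by all of [S_5]. It is thus a nontrivial normal subgroup of the simple group [A_5]. *)
Lemma gen_A5 : <<[set c; c ^ tau]>> = 'Alt_('I_5).
Proof.
have cA := cycle12345_Alt.
set H := <<_>>; have cH : c \in H by rewrite mem_gen ?set21.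
have ctH : c ^ tau \in H by rewrite mem_gen ?set22.
have sHA : H \subset 'Alt_('I_5).
  by rewrite gen_subG subUset !sub1set cA Alt_even odd_permJ -Alt_even.
have nHS : [set: 'S_5] \subset 'N(H).
  rewrite -gen_S5 gen_subG subUset !sub1set; apply/andP; split; last first.
    exact: (subsetP (normG _)).
  rewrite inE -genJ; apply: genS.
  apply/subsetP => _ /imsetP[x /set2P[]-> ->]; rewrite !inE ?eqxx ?orbT //.
  by rewrite -conjgM -{2}transp12V mulgV conjg1 eqxx.
have /simpleP[_ simA] : simple 'Alt_('I_5) by rewrite simple_Alt5 ?card_ord.
have nsH : H <| 'Alt_('I_5).
  by rewrite /normal sHA (subset_trans (subsetT _) nHS).
have [] // := simA [group of H] nsH => /= H1.
move: cH; rewrite H1 => /set1P c1.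
by move: cycle12345_neq1; rewrite c1 eqxx.
Qed.

End SymmetricGroup.

(** * Singular points of the two quartics *)

Section EquationCombinations.
Context (R : pzRingType).
Implicit Types a l r : R.

Lemma eq_mulr a l r : l = r -> a * l = a * r.
Proof. by move->. Qed.

Lemma eq_addr l r l' r' : l = r -> l' = r' -> l + l' = r + r'.
Proof. by move=> -> ->. Qed.

(** With [eq_mulr] and [eq_addr], this proves an equation from an explicit combination of
    hypotheses, leaving a polynomial identity to [ring]. *)
Lemma eq_sub l r l' r' : l = r -> l' - r' = l - r -> l' = r'.
Proof. by move=> ->; rewrite subrr => /eqP; rewrite subr_eq0 => /eqP. Qed.

End EquationCombinations.

Section SingularPoints.
Context (k : fieldType).
Hypothesis char0 : [pchar k] =i pred0.
Implicit Types u v x y z t s : k.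

Lemma natrS_neq0 n : n.+1%:R != 0 :> k.
Proof. by have /pcharf0P -> := char0. Qed.

Lemma exprf_eq0W n x : x ^+ n = 0 -> x = 0.
Proof. by move/eqP; rewrite expf_eq0 => /andP[_ /eqP]. Qed.

(** If [3u = 4v], then [9(u^2 + v^2) = 25 v^2], so [v] vanishes. *)
Lemma sqr_add_eq0 u v : u ^+ 2 + v ^+ 2 = 0 -> u ^+ 3 * (3 * u - 4 * v) = 0 ->
  u = 0 /\ v = 0.
Proof.
move=> uv /eqP; rewrite mulf_eq0 expf_eq0 /= subr_eq0 => /orP[] /eqP eu.
  by move: uv; rewrite eu expr0n add0r => /eqP; rewrite expf_eq0 => /eqP.
have v0 : v = 0.
  apply: (@exprf_eq0W 2); apply: (mulfI (natrS_neq0 24)).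
  apply: (eq_sub (eq_addr (eq_mulr 9 uv) (eq_mulr (- (3 * u + 4 * v)) eu))).
  by ring.
split=> //; apply: (mulfI (natrS_neq0 2)).
by rewrite eu v0 !mulr0.
Qed.

(** [v^2] times the first equation plus [u^2] times the second gives [3(u^2 + v^2)^3 = 0]. Modulo
    [u^2 + v^2] the first equation is then [16 u^3 (3u - 4v) = 0]. *)
Lemma quartic_pair0_eq0 u v :
    3 * (3 * u ^+ 2 - v ^+ 2) ^+ 2 = 64 * u ^+ 3 * v ->
    3 * (u ^+ 2 - 3 * v ^+ 2) ^+ 2 = - 64 * u * v ^+ 3 ->
  u = 0 /\ v = 0.
Proof.
move=> eqF eqG.
have uv : u ^+ 2 + v ^+ 2 = 0.
  apply: (@exprf_eq0W 3); apply: (mulfI (natrS_neq0 2)).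
  by apply: (eq_sub (eq_addr (eq_mulr (v ^+ 2) eqF) (eq_mulr (u ^+ 2) eqG))); ring.
apply: sqr_add_eq0 => //; apply: (mulfI (natrS_neq0 15)).
by apply: (eq_sub (eq_addr eqF (eq_mulr (21 * u ^+ 2 - 3 * v ^+ 2) uv))); ring.
Qed.

(** The combination used for the previous pair now gives [3(u^2 + v^2)H = 0]. If [u^2 + v^2 = 0],
    the first equation reduces to [5 u^3 (3u - 4v) = 0]. If [H = 0], subtracting the first equation
    from [3H] leaves [8 u^2 (3w - 7uv) = 0]. *)
Lemma quartic_pair1_eq0 u v :
    3 * (3 * u ^+ 2 + v ^+ 2 + 3 * u * v) ^+ 2 = 16 * u ^+ 3 * v ->
    3 * (u ^+ 2 + 3 * v ^+ 2 - 3 * u * v) ^+ 2 = - 16 * u * v ^+ 3 ->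
  u = 0 /\ v = 0.
Proof.
move=> eqF eqG.
pose w := v ^+ 2 - u ^+ 2.
pose H := w ^+ 2 + 6 * (u * v) * w + 25 * (u * v) ^+ 2.
have : 3 * ((u ^+ 2 + v ^+ 2) * H) = 0.
  apply: (eq_sub (eq_addr (eq_mulr (v ^+ 2) eqF) (eq_mulr (u ^+ 2) eqG))).
  by rewrite /H /w; ring.
move/eqP; rewrite !mulf_eq0 (negPf (natrS_neq0 2)) /= => /orP[/eqP uv|/eqP H0].
  apply: sqr_add_eq0 => //; apply: (mulfI (natrS_neq0 4)); rewrite mulr0.
  have v2 : v ^+ 2 = - u ^+ 2 by apply/eqP; rewrite -addr_eq0 addrC uv.
  by apply: (eq_sub (eq_mulr (-1) eqF)); ring: v2.
have v_eq0 : u = 0 -> v = 0.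
  move=> u0; apply: (@exprf_eq0W 4).
  by apply: (eq_sub H0); rewrite /H /w u0; ring.
have /eqP : 8 * (u ^+ 2 * (3 * w - 7 * (u * v))) = 0.
  by apply: (eq_sub (eq_addr (eq_mulr 3 H0) (eq_mulr (-1) eqF))); rewrite /H /w; ring.
rewrite !mulf_eq0 (negPf (natrS_neq0 7)) /= orbb => /orP[/eqP u0|/eqP w0].
  by split=> //; apply: v_eq0.
(* [9H = (3w + 25uv)(3w - 7uv) + 400 (uv)^2]. *)
have /eqP : 400 * (u * v) ^+ 2 = 0.
  apply: (eq_sub (eq_addr (eq_mulr 9 H0) (eq_mulr (- (3 * w + 25 * (u * v))) w0))).
  by rewrite /H /w; ring.
rewrite !mulf_eq0 (negPf (natrS_neq0 399)) /= orbb.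
case/orP=> [/eqP u0|/eqP v0]; first by split=> //; apply: v_eq0.
split=> //; apply: (@exprf_eq0W 4).
by apply: (eq_sub H0); rewrite /H /w v0; ring.
Qed.

(* Euler-type relations: with A = (xz)^2 and B = (yt)^2, the products of the
   partial derivatives with their variables are linear in x^3 y, y^3 z, z^3 t,
   t^3 x, A and B; they express the first four through A and B, and then
   (x^3 y)(z^3 t) = A xz yt and (y^3 z)(t^3 x) = B xz yt. *)
Lemma f0_singular s x y z t : s ^+ 2 = 3 ->
    3 * x ^+ 2 * y + t ^+ 3 - s * x * z ^+ 2 = 0 ->
    x ^+ 3 - 3 * y ^+ 2 * z - s * y * t ^+ 2 = 0 ->
    - y ^+ 3 + 3 * z ^+ 2 * t - s * x ^+ 2 * z = 0 ->
    z ^+ 3 + 3 * t ^+ 2 * x - s * y ^+ 2 * t = 0 ->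
  [/\ x = 0, y = 0, z = 0 & t = 0].
Proof.
move=> Hs X Y Z T.
pose A := x ^+ 2 * z ^+ 2; pose B := y ^+ 2 * t ^+ 2.
have comb a b c d : a * (x * (3 * x ^+ 2 * y + t ^+ 3 - s * x * z ^+ 2))
    + b * (y * (x ^+ 3 - 3 * y ^+ 2 * z - s * y * t ^+ 2))
    + c * (z * (- y ^+ 3 + 3 * z ^+ 2 * t - s * x ^+ 2 * z))
    + d * (t * (z ^+ 3 + 3 * t ^+ 2 * x - s * y ^+ 2 * t)) = 0.
  by rewrite X Y Z T !mulr0 !addr0.
(* The multipliers here and below are rows of the inverse, scaled by 80, of the cyclic linear system
   for the four cubic-type monomials. The common factor 10 is then cancelled. *)
have hp : 8 * (x ^+ 3 * y) = s * (3 * A - B).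
  apply: (mulfI (natrS_neq0 9)).
  by apply: (eq_sub (comb 27 (-1) 3 (-9))); rewrite /A /B; ring.
have hq : 8 * (y ^+ 3 * z) = s * (A - 3 * B).
  apply: (mulfI (natrS_neq0 9)).
  by apply: (eq_sub (comb 9 (-27) 1 (-3))); rewrite /A /B; ring.
have hr : 8 * (z ^+ 3 * t) = s * (3 * A - B).
  apply: (mulfI (natrS_neq0 9)).
  by apply: (eq_sub (comb 3 (-9) 27 (-1))); rewrite /A /B; ring.
have hw : 8 * (t ^+ 3 * x) = - s * (A - 3 * B).
  apply: (mulfI (natrS_neq0 9)).
  by apply: (eq_sub (comb (-1) 3 (-9) 27)); rewrite /A /B; ring.
have [||xz _] := @quartic_pair0_eq0 (x * z) (y * t).
- apply: (eq_sub (eq_addr (eq_mulr (- s * (3 * A - B)) hp)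
    (eq_mulr (- 8 * (x ^+ 3 * y)) hr))).
  by rewrite /A /B; ring: Hs.
- apply: (eq_sub (eq_addr (eq_mulr (- s * (A - 3 * B)) hq)
    (eq_mulr (8 * (y ^+ 3 * z)) hw))).
  by rewrite /A /B; ring: Hs.
(* Once [x] or [z] vanishes, the partial derivatives reduce one after the other to single cubes, up
   to sign. *)
move/eqP: xz; rewrite mulf_eq0 => /orP[] /eqP v0.
  have t0 : t = 0 by apply: (@exprf_eq0W 3); rewrite -X v0; ring.
  have y0 : y = 0 by apply: (@exprf_eq0W 3); apply: (eq_sub (eq_mulr (-1) Z)); rewrite v0 t0; ring.
  by split=> //; apply: (@exprf_eq0W 3); rewrite -T v0 t0 y0; ring.
have y0 : y = 0 by apply: (@exprf_eq0W 3); apply: (eq_sub (eq_mulr (-1) Z)); rewrite v0; ring.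
have x0 : x = 0 by apply: (@exprf_eq0W 3); rewrite -Y v0 y0; ring.
by split=> //; apply: (@exprf_eq0W 3); rewrite -X v0 x0 y0; ring.
Qed.

(** The elimination is that of [f0_singular]; the new monomial [m = xyzt] is [(xz)(yt)], so the
    resulting equations still involve only [xz] and [yt]. *)
Lemma f1_singular s x y z t : s ^+ 2 = 3 ->
    3 * x ^+ 2 * y - t ^+ 3 + 2 * s * x * z ^+ 2 + 3 * s * y * z * t = 0 ->
    x ^+ 3 + 3 * y ^+ 2 * z - 2 * s * y * t ^+ 2 + 3 * s * x * z * t = 0 ->
    y ^+ 3 + 3 * z ^+ 2 * t + 2 * s * x ^+ 2 * z + 3 * s * x * y * t = 0 ->
    z ^+ 3 - 3 * t ^+ 2 * x - 2 * s * y ^+ 2 * t + 3 * s * x * y * z = 0 ->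
  [/\ x = 0, y = 0, z = 0 & t = 0].
Proof.
move=> Hs X Y Z T.
pose A := x ^+ 2 * z ^+ 2; pose B := y ^+ 2 * t ^+ 2; pose m := x * y * z * t.
have comb a b c d : a * (x * (3 * x ^+ 2 * y - t ^+ 3 + 2 * s * x * z ^+ 2 + 3 * s * y * z * t))
    + b * (y * (x ^+ 3 + 3 * y ^+ 2 * z - 2 * s * y * t ^+ 2 + 3 * s * x * z * t))
    + c * (z * (y ^+ 3 + 3 * z ^+ 2 * t + 2 * s * x ^+ 2 * z + 3 * s * x * y * t))
    + d * (t * (z ^+ 3 - 3 * t ^+ 2 * x - 2 * s * y ^+ 2 * t + 3 * s * x * y * z)) = 0.
  by rewrite X Y Z T !mulr0 !addr0.
have hp : 4 * (x ^+ 3 * y) = - s * (3 * A + B + 3 * m).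
  apply: (mulfI (natrS_neq0 19)).
  by apply: (eq_sub (comb 27 (-1) 3 (-9))); rewrite /A /B /m; ring.
have hq : 4 * (y ^+ 3 * z) = s * (A + 3 * B - 3 * m).
  apply: (mulfI (natrS_neq0 19)).
  by apply: (eq_sub (comb (-9) 27 (-1) 3)); rewrite /A /B /m; ring.
have hr : 4 * (z ^+ 3 * t) = - s * (3 * A + B + 3 * m).
  apply: (mulfI (natrS_neq0 19)).
  by apply: (eq_sub (comb 3 (-9) 27 (-1))); rewrite /A /B /m; ring.
have hw : 4 * (t ^+ 3 * x) = - s * (A + 3 * B - 3 * m).
  apply: (mulfI (natrS_neq0 19)).
  by apply: (eq_sub (comb 1 (-3) 9 (-27))); rewrite /A /B /m; ring.
have [||xz yt] := @quartic_pair1_eq0 (x * z) (y * t).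
- apply: (eq_sub (eq_addr (eq_mulr (s * (3 * A + B + 3 * m)) hp)
    (eq_mulr (- 4 * (x ^+ 3 * y)) hr))).
  by rewrite /A /B /m; ring: Hs.
- apply: (eq_sub (eq_addr (eq_mulr (- s * (A + 3 * B - 3 * m)) hq)
    (eq_mulr (4 * (y ^+ 3 * z)) hw))).
  by rewrite /A /B /m; ring: Hs.
(* The successive cubes now also need [yt = 0], which removes the mixed term coming from [xyzt]. *)
move/eqP: xz; rewrite mulf_eq0 => /orP[] /eqP v0.
  have t0 : t = 0.
    apply: (@exprf_eq0W 3).
    by apply: (eq_sub (eq_addr (eq_mulr (-1) X) (eq_mulr (3 * s * z) yt))); rewrite v0; ring.
  have y0 : y = 0 by apply: (@exprf_eq0W 3); rewrite -Z v0 t0; ring.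
  by split=> //; apply: (@exprf_eq0W 3); rewrite -T v0 t0 y0; ring.
have y0 : y = 0.
  apply: (@exprf_eq0W 3).
  by apply: (eq_sub (eq_addr Z (eq_mulr (- 3 * s * x) yt))); rewrite v0; ring.
have x0 : x = 0 by apply: (@exprf_eq0W 3); rewrite -Y v0 y0; ring.
split=> //; apply: (@exprf_eq0W 3).
by apply: (eq_sub (eq_mulr (-1) X)); rewrite v0 x0 y0; ring.
Qed.

End SingularPoints.

(** * Quartics invariant under D5 *)

Section Quartics.
Variables (R : comNzRingType).

(** The ring is arbitrary so that the same expression covers both values in [k] and polynomials with
    constant coefficients [c%:MP]. *)
Definition quartic7 (c1 c2 c3 c4 c5 c6 c7 x y z t : R) : R :=
  c1 * (x ^+ 3 * y) + c2 * (y ^+ 3 * z) + c3 * (z ^+ 3 * t)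
  + c4 * (t ^+ 3 * x) + c5 * (x ^+ 2 * z ^+ 2) + c6 * (y ^+ 2 * t ^+ 2)
  + c7 * (x * y * z * t).

(* row1, ..., row4 are the coordinates of 5 R24' (x, y, z, t)^T, with s for the
   square root of 3 and e for the fifth root of unity. *)
Definition row1 (s e x y z t : R) : R :=
  s * (e ^+ 2 - e ^+ 3) * x + (1 + 2 * e ^+ 3 + 2 * e ^+ 4) * y
  + s * (e - e ^+ 4) * z + (1 + 2 * e ^+ 2 + 2 * e ^+ 4) * t.
Definition row2 (s e x y z t : R) : R :=
  (1 + 2 * e ^+ 3 + 2 * e ^+ 4) * x + s * (- e + e ^+ 4) * y
  + (1 + 2 * e ^+ 2 + 2 * e ^+ 4) * z + s * (e ^+ 2 - e ^+ 3) * t.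
Definition row3 (s e x y z t : R) : R :=
  s * (e - e ^+ 4) * x + (1 + 2 * e ^+ 2 + 2 * e ^+ 4) * y
  + s * (- e ^+ 2 + e ^+ 3) * z + (1 + 2 * e + 2 * e ^+ 2) * t.
Definition row4 (s e x y z t : R) : R :=
  (1 + 2 * e ^+ 2 + 2 * e ^+ 4) * x + s * (e ^+ 2 - e ^+ 3) * y
  + (1 + 2 * e + 2 * e ^+ 2) * z + s * (e - e ^+ 4) * t.

Definition quartic7_rows s e c1 c2 c3 c4 c5 c6 c7 x y z t :=
  quartic7 c1 c2 c3 c4 c5 c6 c7
    (row1 s e x y z t) (row2 s e x y z t) (row3 s e x y z t) (row4 s e x y z t).

Variables (s e : R).
Hypothesis (Hs : s ^+ 2 = 3) (He : e ^+ 4 = -1 - e - e ^+ 2 - e ^+ 3).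

(** The coefficients are those of [2 f0'], which clears the halves, and [625 = 5^4] accounts for the
    factor [1/5] in [R24']. *)
Lemma quartic7_rows_f0 x y z t :
  quartic7_rows s e 2 (-2) 2 2 (- s) (- s) 0 x y z t =
  625 * quartic7 2 (-2) 2 2 (- s) (- s) 0 x y z t.
Proof.
rewrite /quartic7_rows /quartic7 /row1 /row2 /row3 /row4.
by ring: Hs He.
Qed.

Lemma quartic7_rows_f1 x y z t :
  quartic7_rows s e 1 1 1 (-1) s (- s) (3 * s) x y z t =
  - 625 * quartic7 1 1 1 (-1) s (- s) (3 * s) x y z t.
Proof.
rewrite /quartic7_rows /quartic7 /row1 /row2 /row3 /row4.
by ring: Hs He.
Qed.

End Quartics.

Lemma rmorph_quartic7 (R S : comNzRingType) (F : {rmorphism R -> S})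
    c1 c2 c3 c4 c5 c6 c7 x y z t :
  F (quartic7 c1 c2 c3 c4 c5 c6 c7 x y z t) =
  quartic7 (F c1) (F c2) (F c3) (F c4) (F c5) (F c6) (F c7)
    (F x) (F y) (F z) (F t).
Proof. by rewrite /quartic7 !(rmorphD, rmorphM, rmorphXn). Qed.

(* The last hypothesis says that the coefficients of x^4, x^2 y^2 and y^4 have
   sum 0.  The multipliers in the proof come from inverting the 5 x 5 system of
   the hypotheses over Q(s, e). *)
Lemma quartic7_rows_eq0 (k : fieldType) (char0 : [pchar k] =i pred0) (s e : k)
    c1 c2 c3 c4 c5 c6 c7 : let q := quartic7_rows s e c1 c2 c3 c4 c5 c6 c7 in
    s ^+ 2 = 3 -> e ^+ 4 = -1 - e - e ^+ 2 - e ^+ 3 ->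
    q 1 0 0 0 = 0 -> q 0 1 0 0 = 0 -> q 0 0 1 0 = 0 -> q 0 0 0 1 = 0 ->
    q 1 1 0 0 + q 1 (-1) 0 0 = 0 ->
  [/\ 9 * c1 = - (s * (6 * c6 + c7)), 9 * c2 = s * (6 * c6 + 3 * c7),
      9 * c3 = - (s * (6 * c6 + c7)), 9 * c4 = - (s * (6 * c6 + 3 * c7))
    & 9 * c5 = 9 * c6 + 6 * c7].
Proof.
(* For a primitive fifth root of unity [e], [h] satisfies [h^2 + h = 1] and generates [Q(sqrt 5)];
   all multipliers below lie in [Q(s, h)]. *)
move=> q Hs He E1 E2 E3 E4 E5; pose h := e ^+ 2 + e ^+ 3.
have comb a1 a2 a3 a4 a5 : a1 * q 1 0 0 0 + a2 * q 0 1 0 0 + a3 * q 0 0 1 0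
    + a4 * q 0 0 0 1 + a5 * (q 1 1 0 0 + q 1 (-1) 0 0) = 0.
  by rewrite E1 E2 E3 E4 E5 !mulr0 !addr0.
have nz500 := natrS_neq0 char0 499.
have qE := (erefl q : q = quartic7_rows s e c1 c2 c3 c4 c5 c6 c7).
split; apply: (mulfI nz500).
- apply: (eq_sub (comb (110 * s) (s * (44 - 12 * h)) (6 * s) (s * (30 + 12 * h)) (- 13 * s))).
  by rewrite qE /quartic7_rows /quartic7 /row1 /row2 /row3 /row4 /h; ring: Hs He.
- apply: (eq_sub (comb (s * (12 * h - 174)) (- 60 * s) (s * (- 18 - 12 * h)) (- 18 * s) (21 * s))).
  by rewrite qE /quartic7_rows /quartic7 /row1 /row2 /row3 /row4 /h; ring: Hs He.
- apply: (eq_sub (comb (110 * s) (s * (56 + 12 * h)) (6 * s) (s * (18 - 12 * h)) (- 13 * s))).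
  by rewrite qE /quartic7_rows /quartic7 /row1 /row2 /row3 /row4 /h; ring: Hs He.
- apply: (eq_sub (comb (s * (186 + 12 * h)) (60 * s) (s * (6 - 12 * h)) (18 * s) (- 21 * s))).
  by rewrite qE /quartic7_rows /quartic7 /row1 /row2 /row3 /row4 /h; ring: Hs He.
- apply: (eq_sub (comb (- 390) (- 120) 18 (- 18) 51)).
  by rewrite qE /quartic7_rows /quartic7 /row1 /row2 /row3 /row4 /h; ring: Hs He.
Qed.

Lemma sum_ord4 (V : nmodType) (F : 'I_4 -> V) :
  \sum_i F i = F (@Ordinal 4 0 isT) + F (@Ordinal 4 1 isT)
               + F (@Ordinal 4 2 isT) + F (@Ordinal 4 3 isT).
Proof.
rewrite !big_ord_recl big_ord0 addr0 !addrA.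
by do !congr (_ + _); congr F; apply: val_inj.
Qed.

Lemma prod_ord4 (R : pzRingType) (F : 'I_4 -> R) :
  \prod_i F i = F (@Ordinal 4 0 isT) * F (@Ordinal 4 1 isT)
               * F (@Ordinal 4 2 isT) * F (@Ordinal 4 3 isT).
Proof.
rewrite !big_ord_recl big_ord0 mulr1 !mulrA.
by do !congr (_ * _); congr F; apply: val_inj.
Qed.

Section InvariantForms.
Context (k : fieldType).
Implicit Types (f : {mpoly k[4]}) (v : 'I_4 -> k).

Local Notation o0 := (@Ordinal 4 0 isT).
Local Notation o1 := (@Ordinal 4 1 isT).
Local Notation o2 := (@Ordinal 4 2 isT).
Local Notation o3 := (@Ordinal 4 3 isT).

Definition quartic7_form (c1 c2 c3 c4 c5 c6 c7 : k) : {mpoly k[4]} :=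
  quartic7 c1%:MP c2%:MP c3%:MP c4%:MP c5%:MP c6%:MP c7%:MP
    'X_o0 'X_o1 'X_o2 'X_o3.

Lemma f0'_quartic7 r3 :
  f0'_poly r3 = quartic7_form 1 (-1) 1 1 (- (r3 / 2)) (- (r3 / 2)) 0.
Proof.
rewrite /f0'_poly /quartic7_form /quartic7 -!mul_mpolyC.
by rewrite !(mpolyCN, mpolyC1, mpolyC0); ring.
Qed.

Lemma f1'_quartic7 r3 :
  f1'_poly r3 = quartic7_form 1 1 1 (-1) r3 (- r3) (3 * r3).
Proof.
rewrite /f1'_poly /quartic7_form /quartic7 -!mul_mpolyC.
by rewrite !(mpolyCN, mpolyC1); ring.
Qed.

Lemma quartic7_formD c1 c2 c3 c4 c5 c6 c7 d1 d2 d3 d4 d5 d6 d7 :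
  quartic7_form c1 c2 c3 c4 c5 c6 c7 + quartic7_form d1 d2 d3 d4 d5 d6 d7 =
  quartic7_form (c1 + d1) (c2 + d2) (c3 + d3) (c4 + d4) (c5 + d5) (c6 + d6) (c7 + d7).
Proof. by rewrite /quartic7_form /quartic7 !mpolyCD; ring. Qed.

Lemma quartic7_formZ a c1 c2 c3 c4 c5 c6 c7 :
  a *: quartic7_form c1 c2 c3 c4 c5 c6 c7 =
  quartic7_form (a * c1) (a * c2) (a * c3) (a * c4) (a * c5) (a * c6) (a * c7).
Proof. by rewrite /quartic7_form /quartic7 -mul_mpolyC !mpolyCM; ring. Qed.

Lemma meval_quartic7 v c1 c2 c3 c4 c5 c6 c7 :
  (quartic7_form c1 c2 c3 c4 c5 c6 c7).@[v] =
  quartic7 c1 c2 c3 c4 c5 c6 c7 (v o0) (v o1) (v o2) (v o3).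
Proof.
by rewrite /quartic7_form /quartic7 !(mevalD, mevalM, rmorphXn) /= !mevalC !mevalXU.
Qed.

Lemma lin_subst_quartic7 A c1 c2 c3 c4 c5 c6 c7 :
  lin_subst A (quartic7_form c1 c2 c3 c4 c5 c6 c7) =
  quartic7 c1%:MP c2%:MP c3%:MP c4%:MP c5%:MP c6%:MP c7%:MP
    (lin_subst A 'X_o0) (lin_subst A 'X_o1) (lin_subst A 'X_o2) (lin_subst A 'X_o3).
Proof.
have C c : lin_subst A c%:MP = c%:MP by apply: comp_mpolyC.
rewrite -[in RHS](C c1) -[in RHS](C c2) -[in RHS](C c3) -[in RHS](C c4).
rewrite -[in RHS](C c5) -[in RHS](C c6) -[in RHS](C c7).
exact: (rmorph_quartic7 (lin_subst A)).
Qed.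

(** * The action of [D5] and [R24'] on quartic forms *)

Section Action.
Variables r3 eps : k.
Hypothesis char0 : [pchar k] =i pred0.
Hypotheses (Hr3 : r3 ^+ 2 = 3) (Heps : 5.-primitive_root eps).

(** Primitivity gives [eps != 1], so [eps - 1] can be cancelled in [eps^5 - 1 = 0]. *)
Lemma eps4E : eps ^+ 4 = -1 - eps - eps ^+ 2 - eps ^+ 3.
Proof.
have eps1 : eps - 1 != 0.
  rewrite subr_eq0; apply/eqP => eps1.
  by have := prim_order_dvd Heps 1; rewrite expr1 eps1 eqxx.
apply: (mulfI eps1); apply/eqP; rewrite -subr_eq0.
have /eqP := prim_expr_order Heps; rewrite -subr_eq0 => /eqP <-.
by apply/eqP; ring.
Qed.

Lemma R24'_row i : lin_subst (5 *: R24' r3 eps) 'X_i =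
  nth 0 [:: row1 r3%:MP eps%:MP 'X_o0 'X_o1 'X_o2 'X_o3;
            row2 r3%:MP eps%:MP 'X_o0 'X_o1 'X_o2 'X_o3;
            row3 r3%:MP eps%:MP 'X_o0 'X_o1 'X_o2 'X_o3;
            row4 r3%:MP eps%:MP 'X_o0 'X_o1 'X_o2 'X_o3] i.
Proof.
have c5 : 5 != 0 :> k by apply: natrS_neq0.
rewrite lin_substXU sum_ord4 /R24' scalerA mulfV // scale1r !mxE.
rewrite -!mul_mpolyC.
by case: i => -[|[|[|[|]]]] //= lti; rewrite /row1 /row2 /row3 /row4; ring.
Qed.

Lemma lin_subst_R24'_f0' : lin_subst (R24' r3 eps) (f0'_poly r3) = f0'_poly r3.
Proof.
have c2 : 2 != 0 :> k by apply: natrS_neq0.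
have c5 : 5 != 0 :> k by apply: natrS_neq0.
(* By homogeneity [5^4] turns [R24'] into [5 R24'], and 2 clears the halves in [f0']. *)
apply: (scalerI (expf_neq0 4 c5)); apply: (scalerI c2).
rewrite -(@lin_substZ _ _ 4) ?f0'_homog // f0'_quartic7 lin_subst_quartic7 !R24'_row.
have Hs : r3%:MP_[4] ^+ 2 = 3 by rewrite -rmorphXn Hr3 rmorph_nat.
have He : eps%:MP_[4] ^+ 4 = -1 - eps%:MP - eps%:MP ^+ 2 - eps%:MP ^+ 3.
  by rewrite -!rmorphXn eps4E !rmorphB rmorphN rmorph1.
have half : 2 * (- (r3 / 2))%:MP_[4] = - r3%:MP.
  by rewrite -(rmorph_nat (@mpolyC 4 k)) -mpolyCM mulrN mulrCA mulfV // mulr1 mpolyCN.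
rewrite -!mul_mpolyC rmorphXn !(rmorph_nat (@mpolyC 4 k)).
rewrite [RHS]mulrCA /quartic7_form.
transitivity (quartic7_rows r3%:MP eps%:MP 2 (-2) 2 2 (- r3%:MP) (- r3%:MP) 0
    'X_o0 'X_o1 'X_o2 'X_o3 : {mpoly k[4]}).
  rewrite /quartic7_rows /quartic7 -half !(mpolyCN, mpolyC1, mpolyC0) /=; ring.
rewrite quartic7_rows_f0 //.
by rewrite /quartic7 -half !(mpolyCN, mpolyC1, mpolyC0); ring.
Qed.

Lemma lin_subst_R24'_f1' : lin_subst (R24' r3 eps) (f1'_poly r3) = - f1'_poly r3.
Proof.
have c5 : 5 != 0 :> k by apply: natrS_neq0.
apply: (scalerI (expf_neq0 4 c5)).
rewrite -(@lin_substZ _ _ 4) ?f1'_homog // f1'_quartic7 lin_subst_quartic7 !R24'_row.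
have Hs : r3%:MP_[4] ^+ 2 = 3 by rewrite -rmorphXn Hr3 rmorph_nat.
have He : eps%:MP_[4] ^+ 4 = -1 - eps%:MP - eps%:MP ^+ 2 - eps%:MP ^+ 3.
  by rewrite -!rmorphXn eps4E !rmorphB rmorphN rmorph1.
rewrite -mul_mpolyC rmorphXn !(rmorph_nat (@mpolyC 4 k)) /quartic7_form.
rewrite !(mpolyCN, mpolyC1, mpolyCM, mpolyC_nat).
rewrite [LHS](quartic7_rows_f1 Hs He).
by ring.
Qed.

Lemma lin_subst_D5_quartic7 c1 c2 c3 c4 c5 c6 c7 :
  lin_subst (D5 eps) (quartic7_form c1 c2 c3 c4 c5 c6 c7) =
  quartic7_form c1 c2 c3 c4 c5 c6 c7.
Proof.
have D5X i : lin_subst (D5 eps) 'X_i =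
    ([:: eps; eps ^+ 2; eps ^+ 4; eps ^+ 3]`_i)%:MP * 'X_i.
  rewrite lin_substXU (bigD1 i) //= big1 => [|j ji].
    by rewrite addr0 !mxE eqxx mulr1n mul_mpolyC.
  by rewrite !mxE eq_sym (negPf ji) mulr0n scale0r.
rewrite lin_subst_quartic7 !D5X /= /quartic7_form !rmorphXn.
have : eps%:MP_[4] ^+ 5 = 1 by rewrite -rmorphXn prim_expr_order // rmorph1.
by rewrite /quartic7 => e5; ring: e5.
Qed.

(** [D5] multiplies [x^a y^b z^c t^d] by [eps^(a + 2b + 4c + 3d)]. Exactly seven monomials of degree
    4 have this exponent divisible by 5. *)
Lemma D5_invariant f : f \is 4.-homog -> lin_subst (D5 eps) f = f ->
  exists c1 c2 c3 c4 c5 c6 c7, f = quartic7_form c1 c2 c3 c4 c5 c6 c7.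
Proof.
move=> homf invf.
pose P g := exists c1 c2 c3 c4 c5 c6 c7, g = quartic7_form c1 c2 c3 c4 c5 c6 c7.
rewrite -/(P f) (mpolyE f) big_seq; apply: (big_ind P).
- do 7!exists 0; rewrite /quartic7_form /quartic7 mpolyC0; ring.
- move=> _ _ [a1 [a2 [a3 [a4 [a5 [a6 [a7 ->]]]]]]] [b1 [b2 [b3 [b4 [b5 [b6 [b7 ->]]]]]]].
  by rewrite quartic7_formD; do 7!eexists.
move=> m fm; suff [c1 [c2 [c3 [c4 [c5 [c6 [c7 ->]]]]]]] : P 'X_[m].
  by rewrite quartic7_formZ; do 7!eexists.
have := dhomog_mf homf fm; rewrite /= mdegE sum_ord4.
have : (5 %| m o0 + 2 * m o1 + 4 * m o2 + 3 * m o3)%N.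
  move/(congr1 (mcoeff m)): invf; rewrite mcoeff_lin_subst_diag prod_ord4 !mxE /=.
  rewrite -[RHS]mul1r => /mulIf; rewrite mcoeff_msupp in fm => /(_ fm) /eqP.
  by rewrite -!exprM -!exprD -(prim_order_dvd Heps).
rewrite [X in P X]mpolyXE_id prod_ord4.
move: (m o0) (m o1) (m o2) (m o3) => a b c d dvd5 sum4.
have : (a, b, c, d) \in [:: (3, 1, 0, 0); (0, 3, 1, 0); (0, 0, 3, 1); (1, 0, 0, 3);
    (2, 0, 2, 0); (0, 2, 0, 2); (1, 1, 1, 1)]%N.
  have le4 : (a + b + c <= 4)%N by rewrite -sum4 leq_addr.
  have eqd : d = (4 - (a + b + c))%N by rewrite -sum4 addKn.
  move: dvd5 le4; rewrite eqd.
  case: a {sum4 eqd} => [|[|[|[|[|a]]]]] //; case: b => [|[|[|[|[|b]]]]] //;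
    by case: c => [|[|[|[|[|c]]]]].
rewrite !inE /P /quartic7_form /quartic7.
by case/or4P=> [|||/or4P[]] /eqP[-> -> -> ->];
  [exists 1, 0, 0, 0, 0, 0, 0 | exists 0, 1, 0, 0, 0, 0, 0
  |exists 0, 0, 1, 0, 0, 0, 0 | exists 0, 0, 0, 1, 0, 0, 0
  |exists 0, 0, 0, 0, 1, 0, 0 | exists 0, 0, 0, 0, 0, 1, 0
  |exists 0, 0, 0, 0, 0, 0, 1]; rewrite mpolyC0 mpolyC1; ring.
Qed.

Lemma meval_R24'_quartic7 c1 c2 c3 c4 c5 c6 c7 v :
  (lin_subst (5 *: R24' r3 eps) (quartic7_form c1 c2 c3 c4 c5 c6 c7)).@[v] =
  quartic7_rows r3 eps c1 c2 c3 c4 c5 c6 c7 (v o0) (v o1) (v o2) (v o3).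
Proof.
have nz5 : 5 != 0 :> k by apply: natrS_neq0.
have mevalE (A : 'M[k]_4) f :
    (lin_subst A f).@[v] = f.@[fun i => \sum_j A i j * v j].
  rewrite /lin_subst comp_mpoly_meval; apply: meval_eq => i.
  rewrite tnth_mktuple raddf_sum; apply: eq_bigr => j _.
  by rewrite /= mevalZ mevalXU.
rewrite mevalE meval_quartic7 /quartic7_rows !sum_ord4 /R24' scalerA mulfV //.
by rewrite scale1r !mxE.
Qed.

(** Both [f] and its transform by [R24'] are combinations of the seven invariant monomials. In the
    transform the coefficients of the fourth powers and of [x^2 y^2] therefore vanish; these five
    conditions express [c1], ..., [c5] through [c6] and [c7]. *)
Lemma invariant_quartic f : f \is 4.-homog -> lin_subst (D5 eps) f = f ->
    lin_subst (D5 eps) (lin_subst (R24' r3 eps) f) = lin_subst (R24' r3 eps) f ->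
  exists a b, f = a *: f0'_poly r3 + b *: f1'_poly r3.
Proof.
move=> homf invf invRf.
have [d1 [d2 [d3 [d4 [d5 [d6 [d7 eqRf]]]]]]] :=
  D5_invariant (lin_subst_homog (R24' r3 eps) homf) invRf.
have [c1 [c2 [c3 [c4 [c5 [c6 [c7 eqf]]]]]]] := D5_invariant homf invf.
have eqq x y z t : quartic7_rows r3 eps c1 c2 c3 c4 c5 c6 c7 x y z t =
    5 ^+ 4 * quartic7 d1 d2 d3 d4 d5 d6 d7 x y z t.
  pose v := fun i : 'I_4 => [:: x; y; z; t]`_i.
  rewrite -(meval_R24'_quartic7 _ _ _ _ _ _ _ v) -eqf (@lin_substZ _ _ 4) // eqRf.
  by rewrite mevalZ meval_quartic7.
have [] := @quartic7_rows_eq0 _ char0 r3 eps c1 c2 c3 c4 c5 c6 c7 Hr3 eps4E.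
1-5: by rewrite !eqq /quartic7; ring.
move=> e1 e2 e3 e4 e5.
have nz9 := natrS_neq0 char0 8; have nz2 := natrS_neq0 char0 1.
pose S := 6 * c6 + 2 * c7.
(* The coefficient of [xyzt] forces [b = c7 / (3 r3) = r3 c7 / 9]; that of [y^2 t^2] then determines
   [a]. *)
exists (- (r3 * S) / 9), (r3 * c7 / 9).
rewrite f0'_quartic7 f1'_quartic7 !quartic7_formZ quartic7_formD eqf.
have : 2 * (r3 / 2) = r3 by rewrite mulrC divfK.
have : 9 * (- (r3 * S) / 9) = - (r3 * S) by rewrite mulrC divfK.
have : 9 * (r3 * c7 / 9) = r3 * c7 by rewrite mulrC divfK.
(* The quotients become variables known only through the three equations above, so that the
   remaining identities are free of division. *)
move: (r3 / 2) (_ / 9) (_ / 9) => h b a eb ea eh.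
have ea' := eq_mulr (-1) ea; have eb' := eq_mulr (-1) eb.
have eqc (c d : k) (eq9 : 9 * c = 9 * d) : c = d by apply: (mulfI nz9).
have eq_form d1' d2' d3' d4' d5' d6' d7' : c1 = d1' -> c2 = d2' -> c3 = d3' ->
    c4 = d4' -> c5 = d5' -> c6 = d6' -> c7 = d7' ->
    quartic7_form c1 c2 c3 c4 c5 c6 c7 = quartic7_form d1' d2' d3' d4' d5' d6' d7'.
  by do 7!move->.
apply: eq_form; apply: eqc.
- by apply: (eq_sub (eq_addr e1 (eq_addr ea' eb'))); rewrite /S; ring.
- by apply: (eq_sub (eq_addr e2 (eq_addr ea eb'))); rewrite /S; ring.
- by apply: (eq_sub (eq_addr e3 (eq_addr ea' eb'))); rewrite /S; ring.
- by apply: (eq_sub (eq_addr e4 (eq_addr ea' eb))); rewrite /S; ring.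
- apply: (mulfI nz2).
  apply: (eq_sub (eq_addr (eq_addr (eq_mulr 2 e5) (eq_mulr (2 * h) ea))
    (eq_addr (eq_mulr (2 * r3) eb') (eq_mulr (- r3 * S) eh)))).
  by rewrite /S; ring: Hr3.
- apply: (mulfI nz2).
  apply: (eq_sub (eq_addr (eq_mulr (2 * h) ea)
    (eq_addr (eq_mulr (2 * r3) eb) (eq_mulr (- r3 * S) eh)))).
  by rewrite /S; ring: Hr3.
- by apply: (eq_sub (eq_mulr (3 * r3) eb')); ring: Hr3.
Qed.

End Action.
End InvariantForms.

(** * Nonsingularity of [f0'] and [f1'] *)

Section Nonsingularity.
Context (k : fieldType).

Local Notation o0 := (@Ordinal 4 0 isT).
Local Notation o1 := (@Ordinal 4 1 isT).
Local Notation o2 := (@Ordinal 4 2 isT).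
Local Notation o3 := (@Ordinal 4 3 isT).

Lemma mderivXU n (i j : 'I_n) : 'X_i^`M(j) = (i == j)%:R :> {mpoly k[n]}.
Proof.
rewrite mderivX mnm1E; case: eqP => [->|_]; last by rewrite scale0r.
by rewrite scale1r -[X in (X - _)%MM]add0m addmK mpolyX0.
Qed.

Lemma meval_mderiv_quartic7 (c1 c2 c3 c4 c5 c6 c7 : k) (v : 'I_4 -> k) j :
  let x := v o0 in let y := v o1 in let z := v o2 in let t := v o3 in
  (quartic7_form c1 c2 c3 c4 c5 c6 c7)^`M(j).@[v] =
  nth 0 [:: 3 * c1 * x ^+ 2 * y + c4 * t ^+ 3 + 2 * c5 * x * z ^+ 2 + c7 * y * z * t;
    c1 * x ^+ 3 + 3 * c2 * y ^+ 2 * z + 2 * c6 * y * t ^+ 2 + c7 * x * z * t;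
    c2 * y ^+ 3 + 3 * c3 * z ^+ 2 * t + 2 * c5 * x ^+ 2 * z + c7 * x * y * t;
    c3 * z ^+ 3 + 3 * c4 * t ^+ 2 * x + 2 * c6 * y ^+ 2 * t + c7 * x * y * z] j.
Proof.
move=> x y z t; rewrite /quartic7_form /quartic7 !exprS !expr0 !mulr1.
rewrite !(mderivD, mderiv_mulC, mderivM, mderivXU) !(mevalD, mevalM, mevalC, mevalXU).
by case: j => -[|[|[|[|]]]] //= ltj; rewrite !(meval0, meval1) -/x -/y -/z -/t; ring.
Qed.

Lemma nonsingular_quartic7 (c1 c2 c3 c4 c5 c6 c7 : k) : c1 != 0 ->
    (forall x y z t,
       3 * c1 * x ^+ 2 * y + c4 * t ^+ 3 + 2 * c5 * x * z ^+ 2 + c7 * y * z * t = 0 ->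
       c1 * x ^+ 3 + 3 * c2 * y ^+ 2 * z + 2 * c6 * y * t ^+ 2 + c7 * x * z * t = 0 ->
       c2 * y ^+ 3 + 3 * c3 * z ^+ 2 * t + 2 * c5 * x ^+ 2 * z + c7 * x * y * t = 0 ->
       c3 * z ^+ 3 + 3 * c4 * t ^+ 2 * x + 2 * c6 * y ^+ 2 * t + c7 * x * y * z = 0 ->
     [/\ x = 0, y = 0, z = 0 & t = 0]) ->
  nonsingular (quartic7_form c1 c2 c3 c4 c5 c6 c7).
Proof.
move=> c1_0 sing; split.
  (* At the point [(1, 1, 0, 0)] only the term [c1 x^3 y] survives. *)
  apply: contra_neq c1_0 => /(congr1 (meval (fun i => [:: 1; 1; 0; 0]`_i))).
  by rewrite meval0 meval_quartic7 /quartic7 /= => <-; ring.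
move=> v v0 _; apply/existsP; apply: contra_neqT v0; rewrite negb_exists.
move/forallP=> dv0; have D j := eqP (negbNE (dv0 j)).
have [] := sing (v o0 0) (v o1 0) (v o2 0) (v o3 0).
- by have := D o0; rewrite meval_mderiv_quartic7.
- by have := D o1; rewrite meval_mderiv_quartic7.
- by have := D o2; rewrite meval_mderiv_quartic7.
- by have := D o3; rewrite meval_mderiv_quartic7.
move=> x0 y0 z0 t0; apply/colP => i; rewrite mxE -x0.
have [->|->|->|->] : [\/ i = o0, i = o1, i = o2 | i = o3].
  case: i => -[|[|[|[|]]]] // lti;
  [constructor 1|constructor 2|constructor 3|constructor 4]; exact: val_inj.
all: by rewrite ?x0 ?y0 ?z0 ?t0.
Qed.

Hypothesis char0 : [pchar k] =i pred0.
Variable (r3 : k).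
Hypothesis Hr3 : r3 ^+ 2 = 3.

Lemma f0'_nonsingular : nonsingular (f0'_poly r3).
Proof.
rewrite f0'_quartic7; apply: nonsingular_quartic7 => [|x y z t]; first exact: oner_neq0.
have half : 2 * - (r3 / 2) = - r3.
  by rewrite mulrN mulrC divfK //; exact: (natrS_neq0 char0 1).
rewrite half => X Y Z T; apply: (f0_singular char0 Hr3).
- by rewrite -X; ring.
- by rewrite -Y; ring.
- by rewrite -Z; ring.
- by rewrite -T; ring.
Qed.

Lemma f1'_nonsingular : nonsingular (f1'_poly r3).
Proof.
rewrite f1'_quartic7; apply: nonsingular_quartic7 => [|x y z t X Y Z T].
  exact: oner_neq0.
apply: (f1_singular char0 Hr3).
- by rewrite -X; ring.
- by rewrite -Y; ring.
- by rewrite -Z; ring.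
- by rewrite -T; ring.
Qed.

End Nonsingularity.

(** * Eigenspaces of the two groups *)

Section Phi2Eigenspaces.
Context (k : closedFieldType).
Hypothesis char0 : [pchar k] =i pred0.
Variables (r3 eps : k).
Hypotheses (Hr3 : r3 ^+ 2 = 3) (Heps : 5.-primitive_root eps).
Variables (phi : {multiplicative 'S_5 -> PGLn k 4}) (phi_inj : injective phi).
Variables (A B : GLn k 4).
Hypotheses (AE : GLmx A = D5 eps) (phiA : phi cycle12345 = PGLclass A).
Hypotheses (BE : GLmx B = R24' r3 eps) (phiB : phi transp12 = PGLclass B).

Local Notation f0 := (f0' r3).
Local Notation f1 := (f1' r3).
Local Notation C := (B * A * B^-1)%g.
Implicit Types (E : {vspace dhomog 4 k 4}) (G : seq (PGLn k 4)).

Lemma f0'_neq0 : f0 != 0.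
Proof.
have [nz _] := f0'_nonsingular char0 Hr3.
by apply: contra_neq nz => /(congr1 val).
Qed.

Lemma f1'_neq0 : f1 != 0.
Proof.
have [nz _] := f1'_nonsingular char0 Hr3.
by apply: contra_neq nz => /(congr1 val).
Qed.

Lemma lin_substA_f0' : lin_subst A f0 = f0.
Proof. by rewrite AE [mpoly_of_dhomog _]f0'_quartic7 lin_subst_D5_quartic7. Qed.

Lemma lin_substA_f1' : lin_subst A f1 = f1.
Proof. by rewrite AE [mpoly_of_dhomog _]f1'_quartic7 lin_subst_D5_quartic7. Qed.

Lemma lin_substB_f0' : lin_subst B f0 = f0.
Proof. by rewrite BE; apply: lin_subst_R24'_f0'. Qed.

Lemma lin_substB_f1' : lin_subst B f1 = - (f1 : {mpoly k[4]}).
Proof. by rewrite BE; apply: lin_subst_R24'_f1'. Qed.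

(** A transposition is its own inverse, so [B] and [B^-1] have the same class. Taking [B^-1] in [C]
    makes it a true conjugate of [A], with the same order and determinant. *)
Lemma phiC : phi (cycle12345 ^ transp12)%g = PGLclass C.
Proof.
have BV : PGLclass B = PGLclass B^-1%g.
  by rewrite -phiB -[in LHS]transp12V multiplicativeV phiB [LHS]PGLV_class.
by rewrite /conjg transp12V !gmulfM phiA phiB [in X in (_ * X)%g]BV !PGLclassM mulgA.
Qed.

Lemma A_expg5 : (A ^+ 5 = 1)%g.
Proof.
apply: val_inj; rewrite !expgS expg0 /= AE /D5 !mulmx1 !mulmx_diag -[RHS]diag_const_mx.
congr diag_mx; apply/rowP => i; rewrite !mxE.
have e5 := prim_expr_order Heps.
by case: i => -[|[|[|[|]]]] //= lti; ring: e5.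
Qed.

(** The exponents 1, 2, 4, 3 add up to 10, a multiple of 5. *)
Lemma detA : \det A = 1.
Proof.
rewrite AE det_diag prod_ord4 !mxE /=.
by have e5 := prim_expr_order Heps; ring: e5.
Qed.

Lemma C_expg5 : (C ^+ 5 = 1)%g.
Proof.
have CX n : (C ^+ n * B = B * A ^+ n)%g.
  elim: n => [|n IH]; first by rewrite !expg0 mul1g mulg1.
  by rewrite !expgS -mulgA IH !mulgA mulgKV.
by apply: (mulIg B); rewrite CX A_expg5 mulg1 mul1g.
Qed.

Lemma detC : \det C = 1.
Proof.
rewrite /= !det_mulmx detA mulr1 -det_mulmx mulmxV ?det1 //.
exact: Defs.GL_unit.
Qed.

(** The degree and the number of variables are both 4, so [acts_by_det], applied with any lift of
    the inverting permutation [r], identifies the scalar with [\det S = 1]. *)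
Lemma acts_by_fifth_root G E (S : GLn k 4) (s r : 'S_5) : eigenspace_of G E ->
    phi s = PGLclass S -> (r * s = s^-1 * r)%g -> phi s \in G -> phi r \in G ->
    (S ^+ 5 = 1)%g -> \det S = 1 ->
  acts_by E S 1.
Proof.
move=> eigE phi_s rs Gs Gr S5 detS.
have E0 : E != 0%VS by case: eigE => m [? [? [? []]]].
have [c Ec] : exists c, acts_by E S c by apply: eigenspace_acts_by eigE _; rewrite -phi_s.
have [R phi_r] : exists R, PGLclass R = phi r.
  by eexists; apply: PGLclass_repr.
have [b Eb] : exists b, acts_by E R b.
  by apply: eigenspace_acts_by eigE _; rewrite phi_r.
suff c1 : c = 1 by rewrite c1 in Ec.
rewrite -detS; apply: (acts_by_det erefl E0 Ec Eb S5).
by rewrite phi_r -phi_s -gmulfM -multiplicativeV -gmulfM rs.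
Qed.

(** Assuming only that [G] contains the image of [A_5] covers both groups. The reversal inverts the
    5-cycle, and its conjugate by the transposition inverts the conjugate cycle. *)
Lemma eigenspace_invariant G E : {subset psi2'_A5 phi <= G} -> eigenspace_of G E ->
  acts_by E A 1 /\ acts_by E C 1.
Proof.
move=> sub eigE.
have inG s : s \in ('Alt_('I_5))%g -> phi s \in G.
  by move=> As; apply: sub; apply: image_f.
have AltJ s : s \in ('Alt_('I_5))%g -> (s ^ transp12)%g \in ('Alt_('I_5))%g.
  by rewrite !Alt_even odd_permJ.
have Gc := cycle12345_Alt; have Gr := rev_ord_Alt5; split.
  apply: (acts_by_fifth_root eigE phiA rev_ord_cycle12345).
  - exact: inG.
  - exact: inG.
  - exact: A_expg5.
  - exact: detA.
apply: (acts_by_fifth_root (r := (perm (@rev_ord_inj 5) ^ transp12)%g) eigE phiC).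
- by rewrite -conjVg -!conjMg rev_ord_cycle12345.
- exact/inG/AltJ.
- exact/inG/AltJ.
- exact: C_expg5.
- exact: detC.
Qed.

(** This follows from [C B = B A]. *)
Lemma lin_subst_conj (f : {mpoly k[4]}) : lin_subst C f = f ->
  lin_subst A (lin_subst B f) = lin_subst B f.
Proof.
move=> Cf; rewrite -{2}Cf -!lin_substM; congr lin_subst.
by rewrite -[RHS]/(GLmx (C * B)%g) mulgKV.
Qed.

Lemma invariantP (f : dhomog 4 k 4) : lin_subst A f = f ->
  lin_subst A (lin_subst B f) = lin_subst B f -> exists a b, f = a *: f0 + b *: f1.
Proof.
rewrite AE BE => Af BAf.
have [a [b eqf]] := invariant_quartic char0 Hr3 Heps (dhomog_is_dhomog f) Af BAf.
by exists a, b; apply: val_inj.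
Qed.

Lemma lin_subst_scale S a (f : dhomog 4 k 4) :
  lin_subst S (a *: f) = a *: lin_subst S f.
Proof. exact: comp_mpolyZ. Qed.

Lemma lin_subst_comb S a b (f g : dhomog 4 k 4) :
  lin_subst S (a *: f + b *: g) = a *: lin_subst S f + b *: lin_subst S g.
Proof.
transitivity (lin_subst S (a *: (f : {mpoly k[4]}) + b *: (g : {mpoly k[4]}))).
  by [].
by rewrite [LHS]comp_mpolyD; congr (_ + _); apply: comp_mpolyZ.
Qed.

Lemma lin_substA_span a b :
  lin_subst A (a *: f0 + b *: f1) = a *: (f0 : {mpoly k[4]}) + b *: (f1 : {mpoly k[4]}).
Proof. by rewrite lin_subst_comb lin_substA_f0' lin_substA_f1'. Qed.

Lemma lin_substB_span a b :
  lin_subst B (a *: f0 + b *: f1) = a *: (f0 : {mpoly k[4]}) - b *: (f1 : {mpoly k[4]}).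
Proof. by rewrite lin_subst_comb lin_substB_f0' lin_substB_f1' scalerN. Qed.

Lemma lin_substC_span a b :
  lin_subst C (a *: f0 + b *: f1) = a *: (f0 : {mpoly k[4]}) + b *: (f1 : {mpoly k[4]}).
Proof.
have -> : GLmx C = B *m A *m GLmx B^-1%g by [].
rewrite !lin_substM lin_substB_span.
have -> : a *: (f0 : {mpoly k[4]}) - b *: (f1 : {mpoly k[4]}) = 
    (a *: f0 + (- b) *: f1 : dhomog 4 k 4) by rewrite scaleNr.
rewrite lin_substA_span scaleNr -lin_substB_span -lin_substM.
by rewrite -[_ *m _]/(GLmx (B * B^-1)%g) mulgV; apply: lin_subst1.
Qed.

Lemma mem_span2 (f : dhomog 4 k 4) :
  f \in <<[:: f0; f1]>>%VS <-> exists a b, f = a *: f0 + b *: f1.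
Proof.
rewrite span_cons span_seq1; split=> [/memv_addP[_ /vlineP[a ->] [_ /vlineP[b ->] ->]]|].
  by exists a, b.
by move=> [a [b ->]]; apply: memv_add; apply/memvZ/memv_line.
Qed.

Lemma scaleN_eq0 (f : dhomog 4 k 4) a : f != 0 ->
  a *: (f : {mpoly k[4]}) = - (a *: (f : {mpoly k[4]})) -> a = 0.
Proof.
move=> f_0 /eqP; rewrite -addr_eq0 -mulr2n -scaler_nat !scaler_eq0.
rewrite (negPf (natrS_neq0 char0 1)) /= => /orP[/eqP //|/eqP v0].
by case/eqP: f_0; apply: val_inj.
Qed.

(** If [f] is fixed by [A] and [B], then so is its transform by [B] under [A], which puts [f] in the
    plane. There [B] negates the [f1'] coordinate, which must vanish as 2 is invertible. *)
Lemma mem_f0'_line (f : dhomog 4 k 4) :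
  f \in <[f0]>%VS <-> lin_subst A f = f /\ lin_subst B f = f.
Proof.
split=> [/vlineP[a ->]|[Af Bf]].
  by rewrite !lin_subst_scale lin_substA_f0' lin_substB_f0'.
have [a [b eqf]] : exists a b, f = a *: f0 + b *: f1.
  exact: (invariantP Af (etrans (congr1 (lin_subst A) Bf) (etrans Af (esym Bf)))).
move: Bf; rewrite eqf lin_substB_span => /addrI/esym/(scaleN_eq0 f1'_neq0) ->.
by rewrite scale0r addr0; apply/memvZ/memv_line.
Qed.

Lemma mem_f1'_line (f : dhomog 4 k 4) : f \in <[f1]>%VS <->
  lin_subst A f = f /\ lin_subst B f = - (f : {mpoly k[4]}).
Proof.
split=> [/vlineP[a ->]|[Af Bf]].
  by rewrite !lin_subst_scale lin_substA_f1' lin_substB_f1' scalerN.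
have [a [b eqf]] : exists a b, f = a *: f0 + b *: f1.
  apply: (invariantP Af); rewrite Bf.
  by rewrite -[X in _ = - X]Af; apply: comp_mpolyN.
move: Bf; rewrite eqf lin_substB_span => Bf.
have /addIr/(scaleN_eq0 f0'_neq0) -> : a *: (f0 : {mpoly k[4]}) - b *: (f1 : {mpoly k[4]}) =
    - (a *: (f0 : {mpoly k[4]})) - b *: (f1 : {mpoly k[4]}) by rewrite Bf -opprD.
by rewrite scale0r add0r; apply/memvZ/memv_line.
Qed.

(* R24' itself has order 4 in GL_4, so it must be rescaled to become a member of
   a generating section. *)
Lemma phi_involution_lift : exists b (B' : GLn k 4),
  [/\ GLmx B' = b *: GLmx B, (B' ^+ 2 = 1)%g, b ^+ 8 = 1 & PGLclass B' = PGLclass B].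
Proof.
have /PGLclass_eqP[a eqBB] : PGLclass (B * B)%g = PGLclass 1%g.
  by rewrite PGLclassM -phiB -gmulfM tperm2 multiplicative1.
have f0_line : <[f0]>%VS != 0%VS by rewrite -dimv_eq0 dim_vline f0'_neq0.
(* The scalar matrix [B^2 = a] multiplies quartics by [a^4], while [B] fixes [f0']. *)
have a4 : a ^+ 4 = 1.
  apply: (acts_by_inj f0_line (A := (B * B)%g)).
    by rewrite -[_ ^+ 4]mulr1; apply: acts_byZ eqBB (@acts_by1 _ _ _ _).
  by rewrite -[1](mulr1 1); apply: acts_byM => f /mem_f0'_line[_ ->]; rewrite scale1r.
(* A square root of [a^-1] exists because [k] is algebraically closed, and then [(b B)^2 = 1]. *)
have [b b2] : exists b, b ^+ 2 = a^-1.
  have [b] := @solve_monicpoly k 2 (fun i => [:: a^-1; 0]`_i) isT.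
  by rewrite !big_ord_recl big_ord0 /= mul0r mulr1 !addr0 => b2; exists b.
have b8 : b ^+ 8 = 1 by rewrite (exprM b 2 4) b2 exprVn a4 invr1.
have b0 : b != 0 by apply: contra_eq_neq b8 => ->; rewrite expr0n eq_sym oner_eq0.
have unitB : b *: GLmx B \in unitmx by rewrite unitmxZ ?unitfE ?Defs.GL_unit.
exists b, (MkGL unitB); split=> //; last by apply/PGLclass_eqP; exists b.
apply: val_inj; rewrite expg2 /= -scalemxAl -scalemxAr scalerA -expr2 b2.
rewrite -[B *m B]/(GLmx (B * B)%g) eqBB scalerA mulVf ?scale1r //.
by apply: contra_eq_neq a4 => ->; rewrite expr0n eq_sym oner_eq0.
Qed.

Lemma order_A : has_order (PGLclass A) 5 /\ has_order A 5.
Proof.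
by have := has_order_lift phi_inj phiA; rewrite order_cycle12345 => /(_ A_expg5).
Qed.

Lemma A5_gen x : x \in psi2'_A5 phi <->
  gen_by (fun y => y = PGLclass A \/ y = PGLclass C) x.
Proof.
transitivity (exists2 s, s \in <<[set cycle12345; cycle12345 ^ transp12]>>%g & x = phi s).
  rewrite gen_A5; split=> [/imageP[s As ->]|[s As ->]]; first by exists s.
  exact: image_f.
rewrite gen_by_image; split; apply: gen_by_sub => y.
  by case=> s /set2P[]-> ->; [left; rewrite phiA | right; rewrite phiC].
case=> ->; [exists cycle12345 | exists (cycle12345 ^ transp12)%g];
  by rewrite ?set21 ?set22 ?phiA ?phiC.
Qed.

Lemma S5_gen D x : PGLclass D = PGLclass B ->
  x \in phi2'_S5 phi <-> gen_by (fun y => y = PGLclass A \/ y = PGLclass D) x.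
Proof.
move=> DB; transitivity (exists2 s, s \in <<[set transp12; cycle12345]>>%g & x = phi s).
  rewrite gen_S5; split=> [/imageP[s As ->]|[s As ->]]; first by exists s; rewrite ?inE.
  exact: image_f.
rewrite gen_by_image DB; split; apply: gen_by_sub => y.
  by case=> s /set2P[]-> ->; [right; rewrite phiB | left; rewrite phiA].
case=> ->; [exists cycle12345 | exists transp12]; by rewrite ?set21 ?set22 ?phiA ?phiB.
Qed.

Lemma A5_eigenspace : eigenspace_of (psi2'_A5 phi) <<[:: f0; f1]>>%VS.
Proof.
have AC : A <> C.
  move=> /(congr1 (@PGLclass _ _)); rewrite -phiC -phiA => /phi_inj eqc.
  exact: cycle12345_conj_neq.
have oC : has_order (PGLclass C) 5 /\ has_order C 5.
  have := has_order_lift phi_inj phiC.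
  by rewrite orderJ order_cycle12345 => /(_ C_expg5).
apply: (eigenspace_of_pair (a := 1) (b := 1) AC A5_gen order_A oC).
- exact: expr1n.
- exact: expr1n.
- move=> f; rewrite !scale1r mem_span2; split=> [[a [b ->]]|[Af Cf]].
    by rewrite lin_substA_span lin_substC_span.
  exact: invariantP Af (lin_subst_conj Cf).
rewrite -subv0; apply/negP => /subvP/(_ f0); rewrite memv0 (negPf f0'_neq0).
by move/(_ (memv_span (mem_head _ _))).
Qed.

Lemma S5_eigenspace (f : dhomog 4 k 4) (c : k) : f != 0 -> c ^+ 2 = 1 ->
    (forall g : dhomog 4 k 4, g \in <[f]>%VS <->
       lin_subst A g = g /\ lin_subst B g = c *: (g : {mpoly k[4]})) ->
  eigenspace_of (phi2'_S5 phi) <[f]>%VS.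
Proof.
move=> f_0 c2 memf.
have [b [B' [eqB' B'2 b8 clB']]] := phi_involution_lift.
have AB' : A <> B'.
  move=> /(congr1 (@PGLclass _ _)); rewrite clB' -phiA -phiB => /phi_inj.
  move/(congr1 (fun s : 'S_5 => #[s]%g)).
  by rewrite order_cycle12345 order_transp12.
have oB' : has_order (PGLclass B') 2 /\ has_order B' 2.
  have phiB' : phi transp12 = PGLclass B' by rewrite clB'.
  by have := has_order_lift phi_inj phiB'; rewrite order_transp12 => /(_ B'2).
have b4 : b ^+ 4 != 0.
  by apply: contra_eq_neq b8 => b4; rewrite (exprM b 4 2) b4 expr0n eq_sym oner_eq0.
(* Passing from [B] to [B' = b B] multiplies the eigenvalue on quartics by [b^4]; its square is
   [b^8 c^2 = 1], as an involution requires. *)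
apply: (eigenspace_of_pair (a := 1) (b := b ^+ 4 * c) AB' (fun x => S5_gen x clB') order_A oB').
- exact: expr1n.
- by rewrite exprMn c2 -exprM b8 mulr1.
- move=> g; rewrite memf scale1r eqB' (@lin_substZ _ _ 4) ?dhomog_is_dhomog //.
  rewrite -scalerA; split=> -[-> Bg]; split=> //; first by rewrite Bg.
  exact: (scalerI b4).
by rewrite -dimv_eq0 dim_vline f_0.
Qed.

Lemma f0'_eigenspace : eigenspace_of (phi2'_S5 phi) <[f0]>%VS.
Proof.
apply: (S5_eigenspace f0'_neq0 (expr1n k 2)) => f.
by rewrite scale1r; apply: mem_f0'_line.
Qed.

Lemma f1'_eigenspace : eigenspace_of (phi2'_S5 phi) <[f1]>%VS.
Proof.
have N1 : (-1) ^+ 2 = 1 :> k by rewrite sqrrN expr1n.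
apply: (S5_eigenspace f1'_neq0 N1) => f.
by rewrite scaleN1r; apply: mem_f1'_line.
Qed.

Lemma psi2'_A5_sub : {subset psi2'_A5 phi <= phi2'_S5 phi}.
Proof. by move=> _ /imageP[s _ ->]; apply: image_f. Qed.

Lemma eigenspace_span G E f : {subset psi2'_A5 phi <= G} -> eigenspace_of G E ->
  f \in E -> f \in <<[:: f0; f1]>>%VS.
Proof.
move=> sub eigE Ef; have [EA EC] := eigenspace_invariant sub eigE.
apply/mem_span2; apply: invariantP; first by rewrite EA // scale1r.
by apply: lin_subst_conj; rewrite EC // scale1r.
Qed.

(** The lift [B'] of order 2 acts by [b^4 c], so [b^8 = 1] yields [c = 1] or [c = -1]. A nonzero
    form of [E] then lies on one of the two eigenlines, and [eigenspace_inj] concludes. *)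
Lemma S5_eigenspace_eq E : eigenspace_of (phi2'_S5 phi) E ->
  E = <[f0]>%VS \/ E = <[f1]>%VS.
Proof.
move=> eigE; have E0 : E != 0%VS by case: eigE => m [? [? [? []]]].
have [EA _] := eigenspace_invariant psi2'_A5_sub eigE.
have [b [B' [eqB' B'2 b8 clB']]] := phi_involution_lift.
have [c EB] : exists c, acts_by E B c.
  by apply: eigenspace_acts_by eigE _; rewrite -phiB; apply: image_f.
have c2 : c ^+ 2 = 1.
  have EB' := acts_byX 2 (acts_byZ eqB' EB); rewrite B'2 in EB'.
  have := acts_by_inj E0 EB' (@acts_by1 _ _ _ E).
  by rewrite exprMn -exprM b8 mul1r.
have Ev := memv_pick E; have v0 : vpick E != 0 by rewrite vpick0.
have Av : lin_subst A (vpick E) = vpick E by rewrite EA // scale1r.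
have /eqP := c2; rewrite sqrf_eq1 => /orP[] /eqP c1; [left | right].
  apply: (eigenspace_inj eigE f0'_eigenspace Ev _ v0).
  by apply/mem_f0'_line; rewrite EB // c1 scale1r.
apply: (eigenspace_inj eigE f1'_eigenspace Ev _ v0).
by apply/mem_f1'_line; rewrite EB // c1 scaleN1r.
Qed.

End Phi2Eigenspaces.

Theorem theorem3p13 (k : closedFieldType) (char0 : [pchar k] =i pred0)
    (r3 eps : k) (Hr3 : r3 ^+ 2 = 3) (Heps : 5.-primitive_root eps)
    (phi : {multiplicative 'S_5 -> PGLn k 4}) (Hphi : is_phi2' r3 eps phi) :
  (forall E : {vspace dhomog 4 k 4},
     nonsingular_eigenspace_of (phi2'_S5 phi) E <->
     E = <[f0' r3]>%VS \/ E = <[f1' r3]>%VS) /\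
  (forall E : {vspace dhomog 4 k 4},
     nonsingular_eigenspace_of (psi2'_A5 phi) E <->
     E = <<[:: f0' r3; f1' r3]>>%VS).
Proof.
have [phi_inj [A AE phiA] [B BE phiB]] := Hphi.
have f0ns := f0'_nonsingular char0 Hr3; have f1ns := f1'_nonsingular char0 Hr3.
have eigA5 := A5_eigenspace char0 Hr3 Heps phi_inj AE phiA BE phiB.
split=> E; split.
- by case=> eigE _; apply: (S5_eigenspace_eq char0 Hr3 Heps phi_inj AE phiA BE phiB).
- case=> ->; split.
  + exact: (f0'_eigenspace char0 Hr3 Heps phi_inj AE phiA BE phiB).
  + by exists (f0' r3); first exact: memv_line.
  + exact: (f1'_eigenspace char0 Hr3 Heps phi_inj AE phiA BE phiB).
  + by exists (f1' r3); first exact: memv_line.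
- case=> eigE _; have E0 : E != 0%VS by case: eigE => m [? [? [? []]]].
  (* Any nonzero form of [E] lies in the plane, itself an eigenspace of the same group. *)
  apply: (eigenspace_inj eigE eigA5 (memv_pick E)); last by rewrite vpick0.
  exact: (eigenspace_span char0 Hr3 Heps AE phiA BE phiB _ eigE (memv_pick E)).
- by move=> ->; split=> //; exists (f0' r3); first by rewrite memv_span ?mem_head.
Qed.
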